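(* Let $(K, v)$ be a Henselian discrete valued field whose residue field $\widehat K$ is finite, and let $q = \mathrm{char}(\widehat K)$. Let $E$ be a Galois extension of $K$ such that $\dim(E) \le 1$. Then $\widehat E(p) = \widehat E$ for every prime $p \neq q$. Moreover, if the value group $v(E)$ is $q$-indivisible (i.e. $v(E) \neq q v(E)$), then $\widehat E(q) = \widehat E$; in particular, $\widehat E$ is algebraically closed.
   Context: A field $F$ has dimension $\le 1$ (written $\dim(F)\le 1$) if the Brauer group $\mathrm{Br}(F')$ is trivial for every algebraic field extension $F'/F$. A valuation $v$ of $K$ is Henselian if it extends uniquely (up to equivalence) to every algebraic extension of $K$; it is discrete if its value group is infinite cyclic. Since $v$ is Henselian, it extends uniquely to a valuation of $E$, again denoted $v$; $v(E)$ is its value group and $\widehat E$ its residue field. For a field $F$ and a prime $p$, $F(p)$ denotes the maximal $p$-extension of $F$ inside a separable closure of $F$. *)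

(* Defs.v *)
From HB Require Import structures.
From mathcomp Require Import all_boot all_order all_algebra all_fingroup all_field.
Set Implicit Arguments. Unset Strict Implicit. Unset Printing Implicit Defensive.
Import Order.TTheory GRing.Theory Num.Theory.
Local Open Scope ring_scope.

(* A (Krull) valuation on a field E with values in an ordered abelian group
   (here a realDomainType); the value at 0 is irrelevant (it stands for +oo). *)
Definition is_valuation (G : realDomainType) (E : fieldType) (w : E -> G) : Prop :=
  (forall x y : E, x != 0 -> y != 0 -> w (x * y) = w x + w y) /\
  (forall x y : E, x != 0 -> y != 0 -> x + y != 0 ->
      Num.min (w x) (w y) <= w (x + y)).

(* Discrete valuation, normalized so that the value group is exactly Z. *)
Definition discrete_valuation (K : fieldType) (v : K -> int) : Prop :=
  is_valuation v /\ exists x : K, x != 0 /\ v x = 1.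

Definition in_vring (G : realDomainType) (E : fieldType) (w : E -> G) (x : E) :=
  x = 0 \/ 0 <= w x.
Definition in_vmax (G : realDomainType) (E : fieldType) (w : E -> G) (x : E) :=
  x = 0 \/ 0 < w x.

(* res : E -> R presents R as the residue field O_w / m_w of w
   (res restricted to O_w is a surjective ring morphism with kernel m_w). *)
Definition residue_map (G : realDomainType) (E : fieldType) (w : E -> G)
    (R : fieldType) (res : E -> R) : Prop :=
  [/\ forall x y, in_vring w x -> in_vring w y -> res (x + y) = res x + res y,
      forall x y, in_vring w x -> in_vring w y -> res (x * y) = res x * res y,
      res 1 = 1,
      forall r : R, exists x, in_vring w x /\ res x = r &
      forall x, in_vring w x -> (res x = 0 <-> in_vmax w x)].

Definition algebraic_ext (K L : fieldType) (i : {rmorphism K -> L}) : Prop :=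
  forall y : L, exists p : {poly K}, p != 0 /\ root (map_poly i p) y.

Definition extends_val (K L : fieldType) (i : {rmorphism K -> L})
    (v : K -> int) (w : L -> rat) : Prop :=
  forall x : K, x != 0 -> w (i x) = (v x)%:~R.

Definition henselian (K : fieldType) (v : K -> int) : Prop :=
  forall (L : fieldType) (i : {rmorphism K -> L}), algebraic_ext i ->
  forall w1 w2 : L -> rat, is_valuation w1 -> is_valuation w2 ->
    extends_val i v w1 -> extends_val i v w2 ->
    forall y : L, y != 0 -> w1 y = w2 y.

Definition galois_ext (K E : fieldType) (i : {rmorphism K -> E}) : Prop :=
  (forall y : E, exists p : {poly K},
      irreducible_poly p /\ separable_poly p /\ root (map_poly i p) y) /\
  (forall p : {poly K}, irreducible_poly p ->
     (exists y : E, root (map_poly i p) y) ->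
     exists r : seq E, map_poly i p %= \prod_(z <- r) ('X - z%:P)).

Definition central_simple (F : fieldType) (A : falgType F) : Prop :=
  (1 : A) != 0 /\
  (forall x : A, (forall y : A, x * y = y * x) -> exists c : F, x = c%:A) /\
  (forall I : {vspace A},
     (forall x a : A, x \in I -> (a * x \in I) && (x * a \in I)) ->
     I = 0%VS \/ I = fullv).

Definition split_algebra (F : fieldType) (A : falgType F) : Prop :=
  exists (n : nat) (f : A -> 'M[F]_n.+1),
    [/\ bijective f,
        forall (c : F) (a b : A), f (c *: a + b) = c *: f a + f b,
        forall a b : A, f (a * b) = f a *m f b &
        f 1 = 1%:M].

Definition brauer_trivial (F : fieldType) : Prop :=
  forall A : falgType F, central_simple A -> split_algebra A.

Definition dim_le1 (E : fieldType) : Prop :=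
  forall (F' : fieldType) (j : {rmorphism E -> F'}), algebraic_ext j ->
    brauer_trivial F'.

(* F(p) = F : F has no nontrivial finite Galois extension of p-power degree *)
Definition p_closed (F : fieldType) (p : nat) : Prop :=
  forall (L : splittingFieldType F) (k : nat),
    galois 1%VS (fullv : {vspace L}) -> \dim (fullv : {vspace L}) = (p ^ k)%N ->
    \dim (fullv : {vspace L}) = 1%N.

Definition alg_closed (F : fieldType) : Prop :=
  forall p : {poly F}, (1 < size p)%N -> exists x : F, root p x.

Definition val_indivisible (E : fieldType) (w : E -> rat) (q : nat) : Prop :=
  exists x : E, x != 0 /\ forall y : E, y != 0 -> w x != q%:R * w y.

(* Main.v *)
Require Import Defs.
From HB Require Import structures.
From mathcomp Require Import all_boot all_order all_algebra all_fingroup all_solvable all_field.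
From mathcomp Require Import boolp classical_sets.
Set Implicit Arguments. Unset Strict Implicit. Unset Printing Implicit Defensive.
Import Order.TTheory GRing.Theory Num.Theory.
Local Open Scope ring_scope.

(* Write R for the residue field of E.  It suffices to show that, for a finite
   extension L of R, every R-automorphism s of L with s^p = 1 is trivial; note that
   every element a of L is algebraic over a finite field, so a is 0 or a root of
   unity of some order N prime to q.

   If v(E) = p v(E) and p <> q, then E contains elements of value 1/p^n for all n.
   Since E/K is normal and all conjugates of such an element have the same value,
   R contains all roots of unity of p-power order.  The automorphism s acts on a and
   on these roots of unity by a common power of the Frobenius, and fixing roots of
   unity of large p-power order makes that power trivial up to a p'-part.

   If v(E) <> p v(E), let g be a monic irreducible factor over E of X^N - 1 whose
   reduction vanishes at a, and M = E[X]/(g), which is Galois over E.  If p divided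
   [M : E], there would be an automorphism tau of M of order p, with fixed field F.
   The valuation extends to M, is tau-invariant by Henselianity, and M/F is
   unramified because distinct N-th roots of unity have distinct residues; so norms
   from M have values in p v(F) <> v(F).  A cyclic algebra (M/F, tau, c) with
   v(c) not in p v(F) is then not split, contradicting dim(E) <= 1.  Hence p does not
   divide deg g, and s fixes a root of the reduction of g; this root is a primitive
   N-th root of unity, so s fixes a as well. *)

(** * Cyclic algebras, their splitting, and norms *)

Section CyclicAlgebra.

Variables (F : fieldType) (M : fieldExtType F).

(** Bundling the automorphism, its relations and the constant into one parameter lets the type
    [cyclic_alg D] determine the multiplication, so that algebra structures can be attached to it.
    Storing the exponent as [cy_n.+1] makes the index type of the coefficients inhabited. *)
Record cyclic_datum := CyclicDatum {
  cy_n : nat;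
  cy_tau : {rmorphism M -> M};
  cy_tau_in_alg : forall c : F, cy_tau c%:A = c%:A;
  cy_tau_iter : forall x, iter cy_n.+1 cy_tau x = x;
  cy_a : F
}.

(** The algebra M + M Y + ... + M Y^(p-1) with Y x = tau(x) Y and Y^p = a, where p is [cy_n.+1]; an
    element is the family of its coefficients. *)
Definition cyclic_alg (D : cyclic_datum) : Type := {ffun 'I_(cy_n D).+1 -> M}.

Variable D : cyclic_datum.
Local Notation n := (cy_n D).
Local Notation p := (cy_n D).+1.
Local Notation tau := (cy_tau D).
Local Notation a := (cy_a D).
Local Notation A := (cyclic_alg D).

HB.instance Definition _ := Vector.copy A {ffun 'I_p -> M}.

Definition cy_coef (u : A) (i : 'I_p) : M := (u : {ffun _ -> _}) i.

Lemma cy_ext (u v : A) : (forall i, cy_coef u i = cy_coef v i) -> u = v.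
Proof. by move=> uv; apply/ffunP. Qed.

Lemma cy_coefD u v i : cy_coef (u + v) i = cy_coef u i + cy_coef v i.
Proof. exact: ffunE. Qed.

Lemma cy_coefB u v i : cy_coef (u - v) i = cy_coef u i - cy_coef v i.
Proof. by rewrite /cy_coef !ffunE. Qed.

Lemma cy_coefZ c u i : cy_coef (c *: u) i = c *: cy_coef u i.
Proof. exact: ffunE. Qed.

Lemma cy_coef0 i : cy_coef 0 i = 0.
Proof. exact: ffunE. Qed.

Lemma cy_coef_sum (I : Type) (r : seq I) (P : pred I) (f : I -> A) i :
  cy_coef (\sum_(k <- r | P k) f k) i = \sum_(k <- r | P k) cy_coef (f k) i.
Proof. exact: (big_morph (cy_coef^~ i) (fun u v => cy_coefD u v i) (cy_coef0 i)). Qed.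

(* The monomial x Y^k, for an arbitrary exponent k: the relation Y^p = a is
   applied k %/ p times. *)
Definition cy_mono (x : M) (k : nat) : A :=
  [ffun i : 'I_p => if (i == k %% p :> nat)%N then (a ^+ (k %/ p)) *: x else 0].

Lemma cy_monoE x k i : cy_coef (cy_mono x k) i =
  if (i == k %% p :> nat)%N then (a ^+ (k %/ p)) *: x else 0.
Proof. exact: ffunE. Qed.

Lemma cy_mono_small x (k i : 'I_p) :
  cy_coef (cy_mono x k) i = if i == k then x else 0.
Proof. by rewrite cy_monoE modn_small // divn_small // expr0 scale1r. Qed.

Lemma cy_monoD x y k : cy_mono (x + y) k = cy_mono x k + cy_mono y k.
Proof.
apply: cy_ext => i; rewrite cy_coefD !cy_monoE.
by case: ifP; rewrite ?addr0 // scalerDr.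
Qed.

Lemma cy_mono0 k : cy_mono 0 k = 0.
Proof.
by apply: cy_ext => i; rewrite cy_coef0 cy_monoE scaler0 if_same.
Qed.

Lemma cy_monoZ c x k : cy_mono (c *: x) k = c *: cy_mono x k.
Proof.
apply: cy_ext => i; rewrite cy_coefZ !cy_monoE.
by case: ifP; rewrite ?scaler0 // !scalerA mulrC.
Qed.

Lemma cy_mono_wrap x c k : cy_mono (a ^+ c *: x) k = cy_mono x (c * p + k).
Proof.
apply: cy_ext => i; rewrite !cy_monoE modnMDl divnMDl //.
by rewrite scalerA -exprD addnC.
Qed.

Lemma cy_sum_mono (u : A) : u = \sum_i cy_mono (cy_coef u i) i.
Proof.
apply: cy_ext => i; rewrite cy_coef_sum (bigD1 i) //= cy_mono_small eqxx.
rewrite big1 ?addr0 // => j ji; rewrite cy_mono_small.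
by rewrite eq_sym (negbTE ji).
Qed.

Lemma tau_iter_mod k x : iter (k %% p) tau x = iter k tau x.
Proof.
rewrite {2}(divn_eq k p) addnC iterD; congr (iter _ _ _).
by elim: (k %/ p)%N => [|c IH]; rewrite ?mulSn ?iterD -?IH ?cy_tau_iter.
Qed.

Lemma tau_iterD k x y : iter k tau (x + y) = iter k tau x + iter k tau y.
Proof. by elim: k => //= k ->; rewrite rmorphD. Qed.

Lemma tau_iterM k x y : iter k tau (x * y) = iter k tau x * iter k tau y.
Proof. by elim: k => //= k ->; rewrite rmorphM. Qed.

Lemma tau_iter_in_alg k (c : F) : iter k tau c%:A = c%:A.
Proof. by elim: k => //= k ->; rewrite cy_tau_in_alg. Qed.

Lemma tau_iterZ k (c : F) x : iter k tau (c *: x) = c *: iter k tau x.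
Proof. by rewrite -mulr_algl tau_iterM tau_iter_in_alg mulr_algl. Qed.

Lemma tau_iter0 k : iter k tau 0 = 0.
Proof. by elim: k => //= k ->; rewrite rmorph0. Qed.

Lemma tau_iter1 k : iter k tau 1 = 1.
Proof. by elim: k => //= k ->; rewrite rmorph1. Qed.

Definition cy_mul (u v : A) : A :=
  \sum_i \sum_j cy_mono (cy_coef u i * iter i tau (cy_coef v j)) (i + j).

Lemma cy_mulDl : left_distributive cy_mul +%R.
Proof.
move=> u v z; rewrite -big_split; apply: eq_bigr => i _ /=.
rewrite -big_split; apply: eq_bigr => j _ /=.
by rewrite cy_coefD mulrDl cy_monoD.
Qed.

Lemma cy_mulDr : right_distributive cy_mul +%R.
Proof.
move=> u v z; rewrite -big_split; apply: eq_bigr => i _ /=.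
rewrite -big_split; apply: eq_bigr => j _ /=.
by rewrite cy_coefD tau_iterD mulrDr cy_monoD.
Qed.

Lemma cy_mul0l v : cy_mul 0 v = 0.
Proof.
rewrite /cy_mul big1 // => i _; rewrite big1 // => j _.
by rewrite cy_coef0 mul0r cy_mono0.
Qed.

Lemma cy_mul0r v : cy_mul v 0 = 0.
Proof.
rewrite /cy_mul big1 // => i _; rewrite big1 // => j _.
by rewrite cy_coef0 tau_iter0 mulr0 cy_mono0.
Qed.

Lemma cy_mul_suml (I : Type) (r : seq I) (P : pred I) (f : I -> A) v :
  cy_mul (\sum_(i <- r | P i) f i) v = \sum_(i <- r | P i) cy_mul (f i) v.
Proof.
exact: (big_morph (cy_mul^~ v) (fun u1 u2 => cy_mulDl u1 u2 v) (cy_mul0l v)).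
Qed.

Lemma cy_mul_sumr (I : Type) (r : seq I) (P : pred I) (f : I -> A) v :
  cy_mul v (\sum_(i <- r | P i) f i) = \sum_(i <- r | P i) cy_mul v (f i).
Proof. exact: (big_morph (cy_mul v) (cy_mulDr v) (cy_mul0r v)). Qed.

(** Allowing arbitrary exponents lets monomials multiply without a case distinction on overflow; the
    unit and associativity laws then reduce to monomials by additivity. *)
Lemma cy_mul_mono x y k l :
  cy_mul (cy_mono x k) (cy_mono y l) = cy_mono (x * iter k tau y) (k + l).
Proof.
have kp m : (m %% p < p)%N by rewrite ltn_mod.
rewrite /cy_mul (bigD1 (Ordinal (kp k))) //= [X in _ + X]big1 ?addr0; last first.
  move=> i; rewrite -val_eqE /= => /negbTE ik; rewrite big1 // => j _.
  by rewrite cy_monoE ik mul0r cy_mono0.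
rewrite (bigD1 (Ordinal (kp l))) //= [X in _ + X]big1 ?addr0; last first.
  move=> i; rewrite -val_eqE /= => /negbTE ik.
  by rewrite [cy_coef (cy_mono y l) i]cy_monoE ik tau_iter0 mulr0 cy_mono0.
rewrite !cy_monoE /= !eqxx tau_iterZ -scalerAr -scalerAl scalerA -exprD.
rewrite cy_mono_wrap tau_iter_mod; congr (cy_mono _ _).
by rewrite [(k %% p + _)%N]addnC mulnDl addnACA -!divn_eq addnC.
Qed.

Definition cy_one : A := cy_mono 1 0.

Lemma cy_mul1l : left_id cy_one cy_mul.
Proof.
move=> u; rewrite {1}(cy_sum_mono u) cy_mul_sumr [RHS]cy_sum_mono.
by apply: eq_bigr => i _; rewrite cy_mul_mono mul1r.
Qed.

Lemma cy_mul1r : right_id cy_one cy_mul.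
Proof.
move=> u; rewrite {1}(cy_sum_mono u) cy_mul_suml [RHS]cy_sum_mono.
by apply: eq_bigr => i _; rewrite cy_mul_mono tau_iter1 mulr1 addn0.
Qed.

Lemma cy_mulA : associative cy_mul.
Proof.
move=> u v z; rewrite (cy_sum_mono u) !cy_mul_suml; apply: eq_bigr => i _.
rewrite (cy_sum_mono v) cy_mul_suml !cy_mul_sumr cy_mul_suml.
apply: eq_bigr => j _.
rewrite (cy_sum_mono z) !cy_mul_sumr; apply: eq_bigr => k _.
by rewrite !cy_mul_mono tau_iterM -iterD mulrA addnA.
Qed.

Lemma cy_one_neq0 : cy_one != 0.
Proof.
apply/eqP => /(congr1 (cy_coef^~ ord0)); rewrite cy_coef0 (cy_mono_small 1 ord0).
by rewrite eqxx => /eqP; rewrite oner_eq0.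
Qed.

HB.instance Definition _ := GRing.Zmodule_isNzRing.Build A
  cy_mulA cy_mul1l cy_mul1r cy_mulDl cy_mulDr cy_one_neq0.

Lemma cy_scaleAl (c : F) (u v : A) : c *: (u * v) = (c *: u) * v.
Proof.
rewrite /GRing.mul /= /cy_mul scaler_sumr; apply: eq_bigr => i _.
rewrite scaler_sumr; apply: eq_bigr => j _.
by rewrite cy_coefZ -scalerAl cy_monoZ.
Qed.

Lemma cy_scaleAr (c : F) (u v : A) : c *: (u * v) = u * (c *: v).
Proof.
rewrite /GRing.mul /= /cy_mul scaler_sumr; apply: eq_bigr => i _.
rewrite scaler_sumr; apply: eq_bigr => j _.
by rewrite cy_coefZ tau_iterZ -scalerAr cy_monoZ.
Qed.

HB.instance Definition _ := GRing.Lmodule_isLalgebra.Build F A cy_scaleAl.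
HB.instance Definition _ := GRing.Lalgebra_isAlgebra.Build F A cy_scaleAr.
HB.instance Definition _ := Algebra_isFalgebra.Build F A.

Lemma cy_monoM x y k l :
  cy_mono x k * cy_mono y l = cy_mono (x * iter k tau y) (k + l) :> A.
Proof. exact: cy_mul_mono. Qed.

Lemma cy_mono_inj k : a != 0 -> injective (cy_mono^~ k).
Proof.
move=> a0 x y xy; have kp : (k %% p < p)%N by rewrite ltn_mod.
move/(congr1 (cy_coef^~ (Ordinal kp))): xy; rewrite !cy_monoE /= eqxx.
by apply: scalerI; rewrite expf_neq0.
Qed.

Lemma cy_mono_unit x k : a != 0 -> x != 0 ->
  exists v, cy_mono x k * v = 1 :> A.
Proof.
move=> a0 x0.
(* The exponent [k * p - k] stands for [-k]: the product has exponent [k * p], and the scalar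
   [a ^+ k] that this contributes is cancelled by [a ^- k]. *)
exists (cy_mono (iter (k * p - k) tau (a ^- k *: x^-1)) (k * p - k)).
have kkp : (k <= k * p)%N by rewrite leq_pmulr.
rewrite cy_monoM -iterD subnKC // -tau_iter_mod modnMl /=.
rewrite -[X in cy_mono _ X]addn0 -cy_mono_wrap -scalerAr scalerA mulfV ?scale1r ?mulfV //.
by rewrite expf_neq0.
Qed.

Hypothesis a_neq0 : a != 0.
Hypothesis tau_faithful :
  forall i, (0 < i < p)%N -> exists x, iter i tau x != x.
Hypothesis tau_fixed : forall x, tau x = x -> exists c : F, x = c%:A.

Lemma tau_iter_inj k : injective (iter k tau).
Proof. by elim: k => //= k IH x y /fmorph_inj/IH. Qed.

Lemma tau_separated (i j : 'I_p) :
  i != j -> exists x, iter i tau x != iter j tau x.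
Proof.
wlog ij : i j / (i < j)%N => [wl ij|_].
  have [/wl|/wl|/val_inj eij] := ltngtP i j; first exact.
    by rewrite eq_sym => /(_ ij) [x xij]; exists x; rewrite eq_sym.
  by rewrite eij eqxx in ij.
have [|x xP] := @tau_faithful (j - i).
  by rewrite subn_gt0 ij (leq_ltn_trans (leq_subr _ _)).
exists x; apply: contra xP => /eqP; rewrite -{1}(subnKC (ltnW ij)) iterD.
by move/tau_iter_inj => <-.
Qed.

(* A nonzero element of a two-sided ideal with smallest support is a monomial,
   hence a unit: commuting it with a scalar of M kills one of its terms. *)
Lemma cy_ideal_one (I : {vspace A}) :
  (forall x a : A, x \in I -> (a * x \in I) && (x * a \in I)) ->
  forall (m : nat) (u : A), (#|[pred i | cy_coef u i != 0%R]| <= m)%N ->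
  u \in I -> u != 0 -> 1 \in I.
Proof.
move=> idI; elim=> [|m IH] u um uI u0.
  case/eqP: u0; apply: cy_ext => i; rewrite cy_coef0; apply/eqP.
  move: um; rewrite leqn0 => /eqP/card0_eq/(_ i).
  by rewrite inE => /negbFE.
have [i ui] : exists i, cy_coef u i != 0.
  apply/existsP; apply: contraR u0; rewrite negb_exists => /forallP ui.
  by apply/eqP/cy_ext => i; rewrite cy_coef0; apply/eqP/negbNE.
pose c x : A := u * cy_mono x 0 - cy_mono (iter i tau x) 0 * u.
have cE x j : cy_coef (c x) j = cy_coef u j * (iter j tau x - iter i tau x).
  rewrite cy_coefB {1 2}(cy_sum_mono u) mulr_suml mulr_sumr !cy_coef_sum.
  rewrite (bigD1 j) //= [X in _ + X - _]big1 ?addr0; last first.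
    move=> k kj; rewrite cy_monoM addn0 cy_mono_small eq_sym (negbTE kj) //.
  rewrite (bigD1 j) //= [X in _ - (_ + X)]big1 ?addr0; last first.
    by move=> k kj; rewrite cy_monoM add0n cy_mono_small eq_sym (negbTE kj).
  by rewrite !cy_monoM addn0 add0n !cy_mono_small eqxx /= mulrBr [_ * cy_coef u j]mulrC.
have cI x : c x \in I.
  by rewrite rpredB //; [case/andP: (idI u (cy_mono x 0) uI)
    | case/andP: (idI u (cy_mono (iter i tau x) 0) uI)].
have cm x : (#|[pred j | cy_coef (c x) j != 0%R]| <= m)%N.
  rewrite -ltnS; apply: leq_trans um; apply: proper_card.
  apply/properP; split; last by exists i; rewrite !inE ?ui // cE subrr mulr0 eqxx.
  by apply/fintype.subsetP => j; rewrite !inE cE mulf_eq0 => /norP [].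
have [c0|[x cx]] : (forall x, c x == 0) \/ exists x, c x != 0.
- case: (boolP [exists j, (j != i) && (cy_coef u j != 0)]) => [|no].
    case/existsP => j /andP [ji uj]; right; have [x xij] := tau_separated ji.
    exists x; apply/eqP => /(congr1 (cy_coef^~ j)); rewrite cE cy_coef0.
    by apply/eqP; rewrite mulf_neq0 // subr_eq0.
  left=> x; apply/eqP/cy_ext => j; rewrite cE cy_coef0.
  have [->|ji] := eqVneq j i; first by rewrite subrr mulr0.
  move: no; rewrite negb_exists => /forallP/(_ j); rewrite ji /= negbK => /eqP->.
  by rewrite mul0r.
- have uE : u = cy_mono (cy_coef u i) i.
    apply: cy_ext => j; rewrite cy_mono_small; case: eqVneq => [->//|ji].
    have [x xij] := tau_separated ji; move/eqP: (c0 x) => /(congr1 (cy_coef^~ j)).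
    rewrite cE cy_coef0 => /eqP; rewrite mulf_eq0 subr_eq0 (negbTE xij) orbF.
    by move/eqP.
  have [v uv] := cy_mono_unit i a_neq0 ui.
  by rewrite -uv -uE; case/andP: (idI u v uI).
- exact: IH (cm x) (cI x) cx.
Qed.

(** Commuting with M leaves a central element only its coefficient at Y^0; commuting with Y makes
    that coefficient fixed by tau, hence a scalar of F. Simplicity comes from [cy_ideal_one]. *)
Lemma cyclic_alg_central_simple : central_simple A.
Proof.
split; first exact: oner_neq0; split=> [u uC|I idI].
  have ui (i : 'I_p) : i != ord0 -> cy_coef u i = 0.
    move=> i0; have [x xi] := tau_separated i0.
    have /(congr1 (cy_coef^~ i)) := uC (cy_mono x 0).
    rewrite {1 2}(cy_sum_mono u) mulr_suml mulr_sumr !cy_coef_sum.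
    rewrite (bigD1 i) //= big1 ?addr0; last first.
      by move=> k kj; rewrite cy_monoM addn0 cy_mono_small eq_sym (negbTE kj).
    rewrite (bigD1 i) //= big1 ?addr0; last first.
      by move=> k kj; rewrite cy_monoM add0n cy_mono_small eq_sym (negbTE kj).
    rewrite !cy_monoM addn0 add0n !cy_mono_small eqxx /= [x * _]mulrC => /eqP.
    by rewrite -subr_eq0 -mulrBr mulf_eq0 subr_eq0 (negbTE xi) orbF => /eqP.
  have uE : u = cy_mono (cy_coef u ord0) 0.
    apply: cy_ext => j; rewrite (cy_mono_small _ ord0).
    by case: eqVneq => [->//|/ui].
  have := uC (cy_mono 1 1); rewrite uE !cy_monoM /= mulr1 mul1r add0n addn0.
  move/(cy_mono_inj a_neq0)/esym/tau_fixed => [c ->]; exists c.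
  by rewrite cy_monoZ.
have [->|I0] := eqVneq I 0%VS; [by left | right].
have := vpick0 I; rewrite (negbTE I0) => /negbT v0.
have I1 := cy_ideal_one idI (leqnn _) (memv_pick I) v0.
apply/eqP; rewrite eqEsubv subvf; apply/subvP => x _.
by have /andP [] := idI 1 x I1; rewrite mulr1.
Qed.

Hypothesis dimM : \dim {:M} = p.

(* When the algebra is split its simple module F^p is one-dimensional over M;
   writing the action of Y on a generator as multiplication by b, the relation
   Y^p = a says that a is the norm of b. *)
Lemma split_cyclic_alg_norm :
  split_algebra A -> exists b : M, \prod_(i < p) iter i tau b = a%:A.
Proof.
case=> m [f [fbij flin fM f1]].
have fsemi : linear f by move=> c u v; rewrite flin.
pose fL := GRing.isLinear.Build F A 'M[F]_m.+1 _ f fsemi.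
pose fl : {linear A -> 'M[F]_m.+1} := HB.pack f fL.
have mp : m.+1 = p.
  have: \dim {: A} = \dim {: 'M[F]_m.+1}.
    have lf0 : lker (linfun fl) == 0%VS.
      by apply/lker0P => u v; rewrite !lfunE; exact: (bij_inj fbij).
    rewrite -(limg_dim_eq (f := linfun fl)) ?(eqP lf0) ?capv0 //; congr (\dim _).
    apply/eqP; rewrite eqEsubv subvf; apply/subvP => x _.
    by case: fbij => g _ fg; rewrite -(fg x) -[f _](lfunE fl) memv_img ?memvf.
  rewrite !dimvf /dim /= card_ord -dimvf dimM => /eqP.
  by rewrite mulnn mulnn eqn_sqr => /eqP.
pose v0 : 'cV[F]_m.+1 := delta_mx 0 0.
have v00 : v0 != 0 by apply/eqP => /matrixP/(_ 0 0)/eqP; rewrite !mxE oner_eq0.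
pose psi (x : M) : 'cV[F]_m.+1 := f (cy_mono x 0) *m v0.
have psilin : linear psi.
  by move=> c x y; rewrite /psi cy_monoD cy_monoZ flin mulmxDl scalemxAl.
pose psiL := GRing.isLinear.Build F M 'cV[F]_m.+1 _ psi psilin.
pose ps : {linear M -> 'cV[F]_m.+1} := HB.pack psi psiL.
have psi0 x : psi x = 0 -> x = 0.
  move=> px; apply/eqP; apply: contraTT isT => x0.
  case/eqP: v00; have xx : cy_mono x^-1 0 * cy_mono x 0 = 1 :> A.
    by rewrite cy_monoM mulVf.
  by rewrite -[v0]mul1mx -f1 -xx fM -mulmxA -/(psi x) px mulmx0.
have psisurj v : exists x, psi x = v.
  have lp0 : lker (linfun ps) == 0%VS.
    rewrite -subv0; apply/subvP => x; rewrite memv_ker lfunE => /eqP/psi0->.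
    exact: mem0v.
  have: v \in limg (linfun ps).
    suff -> : limg (linfun ps) = fullv by exact: memvf.
    apply/eqP; rewrite eqEdim subvf /= limg_dim_eq ?(eqP lp0) ?capv0 // dimM.
    by rewrite dimvf /dim /= muln1 mp.
  by case/memv_imgP => x _ ->; exists x; rewrite lfunE.
have [b Yb] := psisurj (f (cy_mono 1 1) *m v0); exists b.
(* Induction on k: Y (x v0) = tau(x) Y v0 = (tau(x) b) v0. *)
have YX k : f (cy_mono 1 k) *m v0 = psi (\prod_(i < k) iter i tau b).
  elim: k => [|k IH]; first by rewrite big_ord0.
  have -> : cy_mono 1 k.+1 = cy_mono 1 1 * cy_mono 1 k :> A.
    by rewrite cy_monoM mul1r /= rmorph1 add1n.
  rewrite fM -mulmxA IH /psi mulmxA -fM cy_monoM mul1r addn0 /=.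
  rewrite -[X in cy_mono X 1]mulr1.
  have -> : cy_mono (tau (\prod_(i < k) iter i tau b) * 1) 1 =
    cy_mono (tau (\prod_(i < k) iter i tau b)) 0 * cy_mono 1 1 :> A.
    by rewrite cy_monoM.
  rewrite fM -mulmxA -Yb /psi mulmxA -fM cy_monoM /= big_ord_recl /= mulrC.
  by rewrite rmorph_prod.
apply/eqP; rewrite -subr_eq0; apply/eqP/psi0.
rewrite [psi _](linearB ps) /= -YX /psi.
have -> : cy_mono 1 p = cy_mono a%:A 0 by rewrite -[p]mul1n -[(1 * _)%N]addn0 -cy_mono_wrap expr1.
by rewrite subrr.
Qed.

End CyclicAlgebra.

(** This is the form in which the Brauer group enters: the cyclic algebra with constant [a] is
    central simple, hence split, hence [a] is a norm from M. *)
Lemma brauer_trivial_norm (F : fieldType) (M : fieldExtType F)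
    (tau : {rmorphism M -> M}) (n : nat) (a : F) :
  brauer_trivial F -> a != 0 -> \dim {:M} = n.+1 ->
  (forall c : F, tau c%:A = c%:A) -> (forall x, iter n.+1 tau x = x) ->
  (forall i, (0 < i < n.+1)%N -> exists x, iter i tau x != x) ->
  (forall x, tau x = x -> exists c : F, x = c%:A) ->
  exists b : M, \prod_(i < n.+1) iter i tau b = a%:A.
Proof.
move=> brF a0 dimM tauF taun tauX tau1.
pose D := CyclicDatum tauF taun a.
apply: (@split_cyclic_alg_norm F M D) => //; apply: brF.
exact: cyclic_alg_central_simple.
Qed.

(** * Elementary properties of valuations *)

Section ValuationBasics.

Variables (G : realDomainType) (E : fieldType) (w : E -> G).
Hypothesis w_val : is_valuation w.

Lemma valM x y : x != 0 -> y != 0 -> w (x * y) = w x + w y.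
Proof. by case: w_val => + _; apply. Qed.

Lemma val1 : w 1 = 0.
Proof.
have := valM (oner_neq0 E) (oner_neq0 E); rewrite mulr1 => /eqP.
by rewrite -subr_eq0 opprD addrA subrr add0r oppr_eq0 => /eqP.
Qed.

Lemma valV x : x != 0 -> w x^-1 = - w x.
Proof.
move=> x0; apply/eqP; rewrite -addr_eq0 -valM ?invr_eq0 // mulVf //.
by rewrite val1.
Qed.

Lemma valX x n : x != 0 -> w (x ^+ n) = w x *+ n.
Proof.
move=> x0; elim: n => [|n IH]; first by rewrite expr0 val1.
by rewrite exprS mulrS valM ?expf_neq0 // IH.
Qed.

Lemma valXz x (k : int) : x != 0 -> w (x ^ k) = w x *~ k.
Proof.
move=> x0; case: k => k; first exact: valX.
by rewrite NegzE -exprnN valV ?expf_neq0 // valX // mulrNz.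
Qed.

Lemma valN1 : w (- 1) = 0.
Proof.
have n1 : (- 1 : E) != 0 by rewrite oppr_eq0 oner_eq0.
have := valM n1 n1; rewrite mulrNN mulr1 val1 -mulr2n => /esym/eqP.
by rewrite mulrn_eq0 /= => /eqP.
Qed.

Lemma valN x : w (- x) = w x.
Proof.
have [->|x0] := eqVneq x 0; first by rewrite oppr0.
by rewrite -mulN1r valM ?oppr_eq0 ?oner_eq0 // valN1 add0r.
Qed.

Lemma val_prod (I : Type) (r : seq I) (f : I -> E) :
  (forall i, f i != 0) -> w (\prod_(i <- r) f i) = \sum_(i <- r) w (f i).
Proof.
move=> f0; elim: r => [|i r IH]; first by rewrite !big_nil val1.
rewrite !big_cons valM ?IH //; elim/big_ind: _ => //; first exact: oner_neq0.
exact: mulf_neq0.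
Qed.

(* The value at 0 stands for +oo. *)
Definition val_ge (c : G) (x : E) : bool := (x == 0) || (c <= w x).

Definition val_gt (c : G) (x : E) : bool := (x == 0) || (c < w x).

Lemma val_ge0E x : val_ge 0 x <-> in_vring w x.
Proof.
rewrite /val_ge /in_vring; split; first by case/orP=> [/eqP|]; [left|right].
by case=> [->|->]; rewrite ?eqxx ?orbT.
Qed.

Lemma val_gt0E x : val_gt 0 x <-> in_vmax w x.
Proof.
rewrite /val_gt /in_vmax; split; first by case/orP=> [/eqP|]; [left|right].
by case=> [->|->]; rewrite ?eqxx ?orbT.
Qed.

Lemma val_geD c x y : val_ge c x -> val_ge c y -> val_ge c (x + y).
Proof.
rewrite /val_ge; have [->|x0 /= cx] := eqVneq x 0; first by rewrite add0r.
have [->|y0 /= cy] := eqVneq y 0; first by rewrite addr0 cx orbT.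
have [//|xy0 /=] := eqVneq (x + y) 0.
apply: le_trans (proj2 w_val _ _ x0 y0 xy0).
by rewrite le_min cx.
Qed.

Lemma val_gtD c x y : val_gt c x -> val_gt c y -> val_gt c (x + y).
Proof.
rewrite /val_gt; have [->|x0 /= cx] := eqVneq x 0; first by rewrite add0r.
have [->|y0 /= cy] := eqVneq y 0; first by rewrite addr0 cx orbT.
have [//|xy0 /=] := eqVneq (x + y) 0.
apply: lt_le_trans (proj2 w_val _ _ x0 y0 xy0).
by rewrite lt_min cx.
Qed.

Lemma val_geN c x : val_ge c (- x) = val_ge c x.
Proof. by rewrite /val_ge oppr_eq0 valN. Qed.

Lemma val_gtN c x : val_gt c (- x) = val_gt c x.
Proof. by rewrite /val_gt oppr_eq0 valN. Qed.

Lemma val_geB c x y : val_ge c x -> val_ge c y -> val_ge c (x - y).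
Proof. by move=> xc yc; rewrite val_geD // val_geN. Qed.

Lemma val_geM c d x y : val_ge c x -> val_ge d y -> val_ge (c + d) (x * y).
Proof.
rewrite /val_ge; have [->|x0 /= cx] := eqVneq x 0; first by rewrite mul0r eqxx.
have [->|y0 /= cy] := eqVneq y 0; first by rewrite mulr0 eqxx.
by rewrite valM // lerD ?orbT.
Qed.

Lemma val_gtM c d x y : val_gt c x -> val_ge d y -> val_gt (c + d) (x * y).
Proof.
rewrite /val_ge /val_gt; have [->|x0 /= cx] := eqVneq x 0; first by rewrite mul0r eqxx.
have [->|y0 /= cy] := eqVneq y 0; first by rewrite mulr0 eqxx.
by rewrite valM // ltr_leD ?orbT.
Qed.

Lemma val_ge_sum c (I : Type) (r : seq I) (P : pred I) (f : I -> E) :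
  (forall i, P i -> val_ge c (f i)) -> val_ge c (\sum_(i <- r | P i) f i).
Proof.
move=> fc; elim/big_ind: _ => //; first by rewrite /val_ge eqxx.
exact: val_geD.
Qed.

Lemma val_gt_sum c (I : Type) (r : seq I) (P : pred I) (f : I -> E) :
  (forall i, P i -> val_gt c (f i)) -> val_gt c (\sum_(i <- r | P i) f i).
Proof.
move=> fc; elim/big_ind: _ => //; first by rewrite /val_gt eqxx.
exact: val_gtD.
Qed.

Lemma val_ge01 : val_ge 0 1.
Proof. by rewrite /val_ge val1 lexx orbT. Qed.

Lemma val_ge0X x n : val_ge 0 x -> val_ge 0 (x ^+ n).
Proof.
move=> x0; elim: n => [|n IH]; first by rewrite expr0 val_ge01.
by rewrite exprS -[0 : G]addr0 val_geM.
Qed.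

Lemma val_ge_nat n : val_ge 0 n%:R.
Proof.
by elim: n => [|n IH]; [rewrite /val_ge eqxx|rewrite -natr1 val_geD ?val_ge01].
Qed.

End ValuationBasics.

(** * Chevalley's extension of a discrete valuation to an algebraic extension *)

Section ExtensionOfValuations.

Variables (K L : fieldType) (i : {rmorphism K -> L}) (v : K -> int).
Hypothesis v_disc : discrete_valuation v.
Hypothesis i_alg : algebraic_ext i.

Local Notation v_val := (proj1 v_disc).

Definition subring_set (A : set L) : Prop :=
  [/\ A 1, forall x y, A x -> A y -> A (x - y) & forall x y, A x -> A y -> A (x * y)].

Section SubringSet.
Variables (A : set L) (rA : subring_set A).

Lemma subring1 : A 1. Proof. by case: rA. Qed.
Lemma subringB x y : A x -> A y -> A (x - y). Proof. by case: rA => _ + _; apply. Qed.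
Lemma subringM x y : A x -> A y -> A (x * y). Proof. by case: rA => _ _; apply. Qed.
Lemma subring0 : A 0. Proof. by rewrite -(subrr 1); apply: subringB subring1 subring1. Qed.
Lemma subringN x : A x -> A (- x).
Proof. by rewrite -sub0r; apply: subringB subring0. Qed.
Lemma subringD x y : A x -> A y -> A (x + y).
Proof. by move=> Ax Ay; rewrite -[y]opprK; apply: subringB => //; apply: subringN. Qed.
Lemma subringX x n : A x -> A (x ^+ n).
Proof.
move=> Ax; elim: n => [|n IH]; first by rewrite expr0; apply: subring1.
by rewrite exprS; apply: subringM.
Qed.
Lemma subring_sum (I : Type) (r : seq I) (P : pred I) (f : I -> L) :
  (forall k, P k -> A (f k)) -> A (\sum_(k <- r | P k) f k).
Proof. by move=> Af; elim/big_ind: _ => //; [exact: subring0|exact: subringD]. Qed.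

Definition adjoin_set (z : L) : set L :=
  fun y => exists p : {poly L}, (forall k, A p`_k) /\ y = p.[z].

Lemma adjoin_subring z : subring_set (adjoin_set z).
Proof.
split.
- exists 1; rewrite hornerC; split=> // k; rewrite coef1.
  by case: eqP => _; [exact: subring1|exact: subring0].
- move=> _ _ [p [Ap ->]] [r [Ar ->]]; exists (p - r); rewrite hornerD hornerN.
  by split=> // k; rewrite coefB; apply: subringB.
- move=> _ _ [p [Ap ->]] [r [Ar ->]]; exists (p * r); rewrite hornerM.
  by split=> // k; rewrite coefM; apply: subring_sum => l _; apply: subringM.
Qed.

Lemma sub_adjoin z x : A x -> adjoin_set z x.
Proof.
move=> Ax; exists x%:P; rewrite hornerC; split=> // k; rewrite coefC.
by case: eqP => // _; exact: subring0.
Qed.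

Lemma mem_adjoin z : adjoin_set z z.
Proof.
exists 'X; rewrite hornerX; split=> // k; rewrite coefX.
by case: eqP => _; [exact: subring1|exact: subring0].
Qed.

End SubringSet.

Variable t : K.
Hypothesis t0 : t != 0.
Hypothesis vt : v t = 1.
Local Notation s := (i t).

Let s0 : s != 0. Proof. by rewrite fmorph_eq0. Qed.

(** As v is discrete, not inverting the uniformizer amounts to not inverting any nonunit of the
    valuation ring of v. The maximal sets of this kind turn out to be valuation rings of L. *)
Definition dominating (A : set L) : Prop :=
  [/\ subring_set A, forall x, in_vring v x -> A (i x) & ~ A s^-1].

Lemma dominating_base : dominating (fun y => exists2 x, in_vring v x & y = i x).
Proof.
split.
- split.
  + by exists 1; rewrite ?rmorph1 //; apply/val_ge0E/val_ge01/v_val.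
  + move=> _ _ [x /val_ge0E xv ->] [y /val_ge0E yv ->]; exists (x - y).
      exact/val_ge0E/(val_geB v_val).
    by rewrite rmorphB.
  + move=> _ _ [x /val_ge0E xv ->] [y /val_ge0E yv ->]; exists (x * y).
      by apply/val_ge0E; rewrite -[0]addr0; apply: (val_geM v_val).
    by rewrite rmorphM.
- by move=> x xv; exists x.
- case=> x xv; rewrite -fmorphV => /fmorph_inj tx; move: xv; rewrite -tx.
  case=> [/eqP|]; first by rewrite invr_eq0 (negbTE t0).
  by rewrite (valV v_val) // vt.
Qed.

Local Open Scope classical_set_scope.

Lemma exists_maximal_dominating :
  exists A, dominating A /\ forall B, A `<=` B -> dominating B -> B `<=` A.
Proof.
pose P (A : set L) := A = set0 \/ dominating A.
have [|A [PA maxA]] := @Zorn_bigcup L P.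
  move=> F FP totF.
  have [[X0 FX0 dX0]|noX] := pselect (exists2 X, F X & dominating X); last first.
    left; rewrite -subset0 => x [X FX Xx].
    have [X_0|dX] := FP _ FX; first by rewrite X_0 in Xx.
    by case: noX; exists X.
  right; split.
  - have two x y : (\bigcup_(X in F) X) x -> (\bigcup_(X in F) X) y ->
        exists X, [/\ F X, dominating X, X x & X y].
      have dX X z : F X -> X z -> dominating X.
        by move=> FX Xz; have [X_0|//] := FP _ FX; rewrite X_0 in Xz.
      move=> [X FX Xx] [Y FY Yy]; have [XY|YX] := totF _ _ FX FY.
        by exists Y; split=> //; [exact: dX Yy|exact: XY].
      by exists X; split=> //; [exact: dX Xx|exact: YX].
    split.
    + by exists X0 => //; case: dX0 => /subring1.
    + move=> x y /two H /H [X [FX [rX _ _] Xx Xy]].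
      by exists X => //; apply: subringB.
    + move=> x y /two H /H [X [FX [rX _ _] Xx Xy]].
      by exists X => //; apply: subringM.
  - by move=> x xv; exists X0 => //; case: dX0 => _ + _; apply.
  - case=> X FX Xs; have [X_0|[]//] := FP _ FX; by rewrite X_0 in Xs.
have dA : dominating A.
  case: PA => // A0; exfalso.
  apply: (maxA _ _ (or_intror dominating_base)).
  rewrite A0; split=> [x //|/(_ 1)]; apply.
  by exists 1; rewrite ?rmorph1 //; apply/val_ge0E/val_ge01/v_val.
exists A; split=> // B AB dB x Bx; apply: contrapT => nAx.
by apply: (maxA B) (or_intror dB); split=> // /(_ x Bx).
Qed.

Local Close Scope classical_set_scope.

Section MaximalSubring.

Variable A : set L.
Hypothesis dA : dominating A.
Hypothesis maxA : forall B, subset A B -> dominating B -> subset B A.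

Let rA : subring_set A. Proof. by case: dA. Qed.
Let base_A x : in_vring v x -> A (i x). Proof. by case: dA => _ + _; apply. Qed.
Let nAs : ~ A s^-1. Proof. by case: dA. Qed.

Let As : A s.
Proof. by apply: base_A; right; rewrite vt. Qed.

(** By maximality [A[z]] is not dominating, and only the condition on [s^-1] can fail for it. *)
Lemma maximal_adjoin z : ~ A z -> adjoin_set A z s^-1.
Proof.
move=> nAz; apply: contrapT => nzs; apply: nAz.
apply: (maxA (B := adjoin_set A z)); last exact: mem_adjoin.
  by move=> x; apply: sub_adjoin.
split=> //; first exact: adjoin_subring.
by move=> x xv; apply: sub_adjoin (base_A xv).
Qed.

(** If u = 1 + s x were not invertible in A, then 1/s would be a polynomial in 1/u over A.
    Multiplying by a power u^d puts u^d / s in A, and u^d = 1 + s b with b in A then gives 1/s in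
    A. *)
Lemma maximal_principal_unit x : A x -> 1 + s * x != 0 /\ A (1 + s * x)^-1.
Proof.
move=> Ax; have u0 : 1 + s * x != 0.
  apply/eqP => /eqP; rewrite addr_eq0 => /eqP u0; apply: nAs.
  have -> : s^-1 = - x by rewrite -[LHS]mulr1 u0 mulrN mulKf.
  exact: subringN.
split=> //; set u := 1 + s * x in u0 *.
have Au : A u by apply: (subringD rA (subring1 rA)); apply: subringM.
apply: contrapT => /maximal_adjoin [p [Ap sp]]; apply: nAs.
have [b Ab ub] : exists2 b, A b & u ^+ size p = 1 + s * b.
  elim: (size p) => [|d [b Ab ub]].
    by exists 0; [exact: subring0|rewrite mulr0 addr0].
  exists (x + u * b); first by apply: (subringD rA) => //; apply: subringM.
  by rewrite exprS ub mulrDr mulr1 mulrCA {1}/u -addrA -mulrDr.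
have Aus : A (s^-1 * u ^+ size p).
  rewrite sp horner_coef mulr_suml; apply: subring_sum => // k _.
  rewrite -mulrA exprVn; apply: (subringM rA (Ap k)).
  rewrite -[X in u ^+ X](subnK (ltnW (ltn_ord k))) exprD mulrCA.
  rewrite mulVf ?expf_neq0 // mulr1.
  exact: subringX.
have -> : s^-1 = s^-1 * u ^+ size p - b.
  by rewrite ub mulrDr mulr1 mulKf // addrK.
exact: subringB.
Qed.

(* Chevalley's argument: the relation of larger degree can be shortened by
   means of the other one. *)
Lemma maximal_no_two_relations (N : nat) : forall (z : L) (p r : {poly L}), z != 0 ->
  (size p + size r <= N)%N -> (forall k, A p`_k) -> (forall k, A r`_k) ->
  s^-1 = p.[z] -> s^-1 = r.[z^-1] -> False.
Proof.
elim: N => [|N IH] z p r z0 szN Ap Ar sp sr.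
  move: szN; rewrite leqn0 addn_eq0 size_poly_eq0 => /andP [/eqP p0 _].
  by move: sp; rewrite p0 horner0 => /eqP; rewrite invr_eq0 (negbTE s0).
wlog szr : z p r z0 szN Ap Ar sp sr / (size r <= size p)%N => [wl|].
  have [?|/ltnW ?] := leqP (size r) (size p); first exact: (wl z p r).
  apply: (wl z^-1 r p) => //; rewrite ?invr_eq0 ?invrK //.
  by rewrite addnC.
case: (posnP (size p)) => [/eqP|].
  rewrite size_poly_eq0 => /eqP p0.
  by move: sp; rewrite p0 horner0 => /eqP; rewrite invr_eq0 (negbTE s0).
move: szr szN; case def_m: (size p) => [//|m] szr szN _.
have [u0 Au] := maximal_principal_unit (subringN rA (Ar 0%N)).
set u := 1 + _ in u0 Au.
(* Multiplying the relation for [z^-1] by s z^m and isolating its constant term gives (1 - s r_0)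
   z^m = s S(z) with deg S < m; this replaces the top power z^m in p. *)
pose S := \poly_(j < m) r`_(m - j).
have AS k : A S`_k by rewrite coef_poly; case: ifP => // _; exact: subring0.
have uz : u * z ^+ m = s * S.[z].
  have: s * r.[z^-1] * z ^+ m = z ^+ m by rewrite -sr mulfV // mul1r.
  rewrite (horner_coef_wide _ szr) -mulrA mulr_suml big_ord_recl /= expr0 mulr1.
  rewrite mulrDr => rz; rewrite /u mulrDl mul1r -{1}rz mulrN mulNr mulrA.
  rewrite [X in X - _]addrC addrK; congr (_ * _).
  rewrite horner_poly (reindex_inj rev_ord_inj) /=; apply: eq_bigr => j _.
  rewrite /bump /= add1n subnSK // -mulrA exprVn; congr (_ * _).
  rewrite mulrC -[X in z ^+ X / _](subnK (ltnW (ltn_ord j))) addnC exprD.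
  by rewrite mulfK ?expf_neq0.
pose p' := \poly_(j < m) p`_j + (p`_m * u^-1 * s) *: S.
apply: (IH z p' r) => //.
- rewrite -ltnS; apply: leq_trans szN; rewrite -addSn leq_add2r ltnS.
  apply: leq_trans (size_polyD _ _) _; rewrite geq_max size_poly.
  by apply: leq_trans (size_scale_leq _ _) _; apply: size_poly.
- move=> k; rewrite coefD coefZ; apply: subringD => //.
    by rewrite coef_poly; case: ifP => // _; exact: subring0.
  by apply: subringM => //; apply: subringM => //; apply: subringM.
- rewrite sp hornerD hornerZ horner_poly horner_coef def_m big_ord_recr /=.
  by congr (_ + _); rewrite -[_ * s * _]mulrA -uz mulrA mulfVK.
Qed.

Lemma maximal_valuation_ring z : z != 0 -> A z \/ A z^-1.
Proof.
move=> z0; apply: contrapT => /not_orP [/maximal_adjoin [p [Ap sp]]].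
by move=> /maximal_adjoin [r [Ar sr]]; apply: maximal_no_two_relations (leqnn _) Ap Ar sp sr.
Qed.

Definition ring_unit (x : L) : Prop := [/\ x != 0, A x & A x^-1].

Lemma ring_unitM x y : ring_unit x -> ring_unit y -> ring_unit (x * y).
Proof.
move=> [x0 Ax Ax'] [y0 Ay Ay']; split; rewrite ?mulf_neq0 ?invfM //.
  exact: subringM.
exact: subringM.
Qed.

Lemma ring_unitV x : ring_unit x -> ring_unit x^-1.
Proof. by move=> [x0 Ax Ax']; split; rewrite ?invr_eq0 ?invrK. Qed.

Lemma ring_unit1 : ring_unit 1.
Proof. by split; rewrite ?invr1 ?oner_neq0 //; exact: subring1. Qed.

Lemma ring_unitX x n : ring_unit x -> ring_unit (x ^+ n).
Proof.
move=> Ux; elim: n => [|n IH]; first by rewrite expr0; exact: ring_unit1.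
by rewrite exprS; apply: ring_unitM.
Qed.

Lemma ring_unit_base c : c != 0 -> v c = 0 -> ring_unit (i c).
Proof.
move=> c0 vc; split; rewrite ?fmorph_eq0 -?fmorphV //.
  by apply: base_A; right; rewrite vc.
by apply: base_A; right; rewrite (valV v_val) // vc.
Qed.

Lemma ring_unit_uniformizer (k : int) : ring_unit (s ^ k) -> k = 0.
Proof.
wlog k0 : k / 0 <= k => [wl Uk|].
  have [/wl|/ltW k0] := leP 0 k; first exact.
  apply: oppr_inj; rewrite oppr0; apply: wl; first by rewrite oppr_ge0.
  by rewrite -invr_expz; apply: ring_unitV.
case: k k0 => // -[//|k] _ [_ _ Ak]; case: nAs.
have -> : s^-1 = s ^+ k * (s ^ k.+1)^-1.
  by rewrite exprSz -exprnP invfM mulrCA mulfV ?expf_neq0 // mulr1.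
by apply: subringM => //; apply: subringX.
Qed.

(** A valuation ring is local: if y/(u+y) lies in A, it yields the inverse of u+y; if (u+y)/y does,
    it yields an inverse of y, which is excluded. *)
Lemma ring_unitD u y : ring_unit u -> A y -> y = 0 \/ ~ A y^-1 ->
  ring_unit (u + y).
Proof.
move=> Uu Ay; have [u0 Au Au'] := Uu.
have [->|y0] := eqVneq y 0; first by rewrite addr0.
case=> [/eqP|nAy]; first by rewrite (negbTE y0).
have uy0 : u + y != 0.
  apply/eqP => /eqP; rewrite addr_eq0 => /eqP uE; apply: nAy.
  have -> : y^-1 = - u^-1 by rewrite uE invrN opprK.
  exact: subringN.
split=> //; first exact: subringD.
have yuy0 : y / (u + y) != 0 by rewrite mulf_neq0 ?invr_eq0.
have [Ayz|] := maximal_valuation_ring yuy0.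
- have -> : (u + y)^-1 = u^-1 * (1 - y / (u + y)).
    rewrite -[X in X - _](mulfV uy0) -mulrBl addrK mulrA mulVf // mul1r //.
  by apply: subringM => //; apply: (subringB rA (subring1 rA)).
- rewrite invfM invrK mulrC => Azy; case: nAy.
  have -> : y^-1 = u^-1 * ((u + y) / y - 1).
    by rewrite -[X in _ - X](mulfV y0) -mulrBl addrK mulrA mulVf // mul1r.
  by apply: subringM => //; apply: (subringB rA _ (subring1 rA)).
Qed.

(** The ultrametric principle before any valuation is available: either two terms have the same
    size, or the largest term determines the size of the sum. A vanishing sum therefore has two
    terms of the same size. *)
Lemma sum_unit_ratio (r : seq L) : r != [::] -> all (fun x => x != 0) r ->
  (exists j k, (j < k < size r)%N /\ ring_unit (r`_j / r`_k)) \/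
  (exists k, (k < size r)%N /\ ring_unit ((\sum_(x <- r) x) / r`_k)).
Proof.
elim: r => [//|x r IH] _ /= /andP [x0 r0].
case: (eqVneq r [::]) => [->|rn].
  by right; exists 0%N; rewrite big_seq1 mulfV //; split=> //; exact: ring_unit1.
case: (IH rn r0) => [[j [k [jk Ujk]]]|[k [kr Uk]]].
  by left; exists j.+1, k.+1.
have e0 : r`_k != 0 by apply: (allP r0); apply: mem_nth.
have [Uxe|nUxe] := pselect (ring_unit (x / r`_k)).
  by left; exists 0%N, k.+1.
right; rewrite big_cons; set S := \sum_(_ <- _) _ in Uk *.
have xe0 : x / r`_k != 0 by rewrite mulf_neq0 ?invr_eq0.
have [Axe|Aex] := maximal_valuation_ring xe0.
  exists k.+1; split=> //=; rewrite mulrDl addrC; apply: ring_unitD => //.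
  by right=> Aex; apply: nUxe; split.
exists 0%N; split=> //=; rewrite mulrDl mulfV //.
have [U0 AU AU'] := Uk.
have -> : S / x = S / r`_k * (x / r`_k)^-1.
  by rewrite invfM invrK mulrACA mulVf // mulr1.
apply: ring_unitD; [exact: ring_unit1|exact: subringM|right].
rewrite invfM invrK => AA; apply: nUxe; split=> //.
have -> : x / r`_k = S / r`_k * ((S / r`_k)^-1 * (x / r`_k)).
  by rewrite mulrA mulfV // mul1r.
exact: subringM.
Qed.

(** The value of x is m/n when x^n and s^m differ by a unit of A. It is a relation because only the
    quotient of m by n is determined by x. *)
Definition ring_value (x : L) (c : rat) : Prop :=
  exists n (m : int), [/\ (0 < n)%N, ring_unit (x ^+ n * s ^ (- m)) & c = m%:~R / n%:R].

(** In an algebraic equation of x over K two terms have a unit as ratio, so some power x^n is a unit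
    times an element of K, that is, times a power of the uniformizer. *)
Lemma exists_ring_value x : x != 0 -> exists c, ring_value x c.
Proof.
move=> x0; have [p [p0 px]] := i_alg x.
pose ks := [seq k <- iota 0 (size p) | p`_k != 0].
pose f k := i p`_k * x ^+ k.
have kP j : (j < size ks)%N -> p`_(nth 0%N ks j) != 0.
  by move=> jk; have := mem_nth 0%N jk; rewrite mem_filter => /andP [].
have sumf : \sum_(y <- map f ks) y = 0.
  rewrite big_map big_filter -[RHS](rootP px) horner_coef size_map_poly.
  rewrite -(big_mkord xpredT (fun k => (map_poly i p)`_k * x ^+ k)).
  rewrite /index_iota subn0 big_mkcond /=.
  apply: eq_bigr => k _; rewrite coef_map /f; case: eqP => //= ->.
  by rewrite rmorph0 mul0r.
have ks0 : map f ks != [::].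
  rewrite -size_eq0 size_map size_eq0 -has_filter; apply/hasP.
  exists (size p).-1; last by rewrite -lead_coefE lead_coef_eq0.
  by rewrite mem_iota /= add0n prednK // size_poly_gt0.
have allf : all (fun y => y != 0) (map f ks).
  apply/allP => _ /mapP [k kk ->]; rewrite mulf_neq0 ?expf_neq0 // fmorph_eq0.
  by move: kk; rewrite mem_filter => /andP [].
have [[j [k []]]|[k [_]]] := sum_unit_ratio ks0 allf; last first.
  by rewrite sumf mul0r => -[]; rewrite eqxx.
rewrite size_map => /andP [jk kks]; have jks := ltn_trans jk kks.
rewrite !(nth_map 0%N) //; set J := nth _ _ j; set k' := nth _ _ k => /ring_unitV.
have Jk : (J < k')%N.
  apply: (sorted_ltn_nth ltn_trans 0%N) => //.
  by apply: sorted_filter; [exact: ltn_trans|exact: iota_ltn_sorted].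
have pJ : p`_J != 0 by exact: kP.
have pk : p`_k' != 0 by exact: kP.
pose c := p`_k' / p`_J; have c0 : c != 0 by rewrite mulf_neq0 ?invr_eq0.
have -> : (f J / f k')^-1 = i c * x ^+ (k' - J).
  have -> : f k' = i p`_k' * (x ^+ (k' - J) * x ^+ J).
    by rewrite -exprD subnK // ltnW.
  rewrite invf_div mulrA /f invfM mulrACA mulfV ?expf_neq0 // mulr1 mulrAC.
  by rewrite /c rmorphM fmorphV.
clearbody c; move=> Uc; exists ((- v c)%:~R / (k' - J)%:R), (k' - J)%N, (- v c).
split=> //; first by rewrite subn_gt0.
rewrite opprK.
have tz0 : t ^ v c != 0 by rewrite expfz_neq0.
have -> : x ^+ (k' - J) * s ^ v c = (i c * x ^+ (k' - J)) * i (t ^ v c / c).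
  rewrite fmorph_div fmorphXz mulrC [RHS]mulrC mulrA.
  by rewrite -[s ^ v c / i c * i c]mulrA mulVf ?fmorph_eq0 // mulr1.
apply: ring_unitM => //; apply: ring_unit_base.
  by rewrite mulf_neq0 ?invr_eq0.
rewrite (valM v_val) ?invr_eq0 // (valV v_val) // (valXz v_val) // vt.
by rewrite intz subrr.
Qed.

(** Eliminating x between two comparisons leaves a power of [s] that is a unit, and its exponent
    must vanish. *)
Lemma ring_value_uniq x c d : x != 0 -> ring_value x c -> ring_value x d -> c = d.
Proof.
move=> x0 [n [m [n0 Un ->]]] [n' [m' [n'0 Un' ->]]].
have U : ring_unit (s ^ (m' * n - m * n')).
  have := ring_unitM (ring_unitX n' Un) (ring_unitV (ring_unitX n Un')).
  rewrite !exprMn -!exprM [(n' * n)%N]mulnC invfM mulrACA mulfV ?expf_neq0 //.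
  rewrite mul1r !exprnP !exprz_exp invr_expz -expfzDr // => U.
  by move: U; rewrite !mulNr opprK addrC.
move/ring_unit_uniformizer/eqP: U; rewrite subr_eq0 => /eqP E.
apply/eqP; rewrite eqr_div ?pnatr_eq0 -?lt0n // !pmulrn -!intrM E.
exact: eqxx.
Qed.

Lemma ring_valueM x y c d : ring_value x c -> ring_value y d ->
  ring_value (x * y) (c + d).
Proof.
move=> [n [m [n0 Un ->]]] [n' [m' [n'0 Un' ->]]].
exists (n * n')%N, (m * n' + m' * n); split; first by rewrite muln_gt0 n0.
  have := ring_unitM (ring_unitX n' Un) (ring_unitX n Un').
  rewrite !exprMn -!exprM [(n' * n)%N]mulnC mulrACA -exprMn.
  by rewrite [_ ^+ n']exprnP [_ ^+ n]exprnP !exprz_exp -expfzDr // !mulNr -opprD.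
rewrite addf_div ?pnatr_eq0 -?lt0n // natrM intrD !intrM.
by rewrite -!pmulrn.
Qed.

(** If m is nonnegative, x^n is in A, and so is x: should only 1/x be known to lie in A, then x =
    x^n (1/x)^(n-1). If m is negative, x in A would give 1/s in A. *)
Lemma ring_value_ge0 x c : x != 0 -> ring_value x c -> (0 <= c <-> A x).
Proof.
move=> x0 [n [m [n0 [_ Um Um'] ->]]].
have -> : (0 <= m%:~R / n%:R :> rat) = (0 <= m).
  by rewrite pmulr_lge0 ?ler0z // invr_gt0 ltr0n.
split=> [m0|Ax].
  have Axn : A (x ^+ n).
    have -> : x ^+ n = x ^+ n * s ^ (- m) * s ^ m.
      by rewrite -mulrA -expfzDr // addNr expr0z mulr1.
    apply: subringM => //; case: m m0 {Um Um'} => // k _; exact: subringX.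
  have [//|Ax'] := maximal_valuation_ring x0.
  case: n n0 Axn {Um Um'} => // n _ Axn.
  have -> : x = x ^+ n.+1 * x^-1 ^+ n.
    by rewrite exprVn exprS mulfK // expf_neq0.
  by apply: subringM => //; apply: subringX.
rewrite leNgt; apply/negP; case: m Um Um' => // k Um Um' _; apply: nAs.
have -> : s^-1 = s ^+ k * (x ^+ n * (x ^+ n * s ^ (- Negz k))^-1).
  rewrite NegzE opprK invfM [x ^+ n * (_ * _)]mulrA mulfV ?expf_neq0 // mul1r.
  rewrite exprSz -exprnP.
  by rewrite invfM mulrCA mulfV ?expf_neq0 // mulr1.
by apply: subringM; rewrite //; [apply: subringX|apply: subringM => //; apply: subringX].
Qed.

End MaximalSubring.

Lemma valuation_extension_aux :
  exists w : L -> rat, is_valuation w /\ extends_val i v w.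
Proof.
have [A [dA maxA]] := exists_maximal_dominating.
have /choice [w wP] : forall x, exists c, x != 0 -> ring_value A x c.
  move=> x; have [->|x0] := eqVneq x 0; first by exists 0.
  by have [c xc] := exists_ring_value dA maxA x0; exists c.
have wM x y : x != 0 -> y != 0 -> w (x * y) = w x + w y.
  move=> x0 y0; have xy0 := mulf_neq0 x0 y0.
  apply: (ring_value_uniq dA xy0 (wP _ xy0)).
  by apply: (ring_valueM dA); apply: wP.
have w1 : w 1 = 0.
  have := wM _ _ (oner_neq0 L) (oner_neq0 L); rewrite mulr1 => /eqP.
  by rewrite -subr_eq0 opprD addrA subrr add0r oppr_eq0 => /eqP.
have wV x : x != 0 -> w x^-1 = - w x.
  by move=> x0; apply/eqP; rewrite -addr_eq0 -wM ?invr_eq0 // mulVf // w1.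
exists w; split; first split=> // x y x0 y0 xy0.
  wlog xy : x y x0 y0 xy0 / w x <= w y => [wl|].
    have [xy|/ltW yx] := leP (w x) (w y).
      by have := wl x y x0 y0 xy0 xy; rewrite (min_idPl xy).
    have := wl y x y0 x0; rewrite [y + x]addrC => /(_ xy0 yx).
    by rewrite (min_idPl yx).
  rewrite (min_idPl xy); have yx0 : y / x != 0 by rewrite mulf_neq0 ?invr_eq0.
  have yx1 : 1 + y / x != 0 by rewrite -(mulfV x0) -mulrDl mulf_neq0 ?invr_eq0.
  have -> : x + y = x * (1 + y / x) by rewrite mulrDr mulr1 mulrC mulfVK.
  have rA : subring_set A by case: dA.
  rewrite wM // lerDl; apply/(ring_value_ge0 dA maxA yx1 (wP _ yx1)).
  apply: (subringD rA (subring1 rA)).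
  apply/(ring_value_ge0 dA maxA yx0 (wP _ yx0)).
  by rewrite wM ?invr_eq0 // wV // subr_ge0.
move=> x x0; have ix0 : i x != 0 by rewrite fmorph_eq0.
apply: (ring_value_uniq dA ix0 (wP _ ix0)).
exists 1%N, (v x); split=> //; last by rewrite divr1.
rewrite expr1 -fmorphXz -rmorphM; apply: (ring_unit_base dA).
  by rewrite mulf_neq0 ?expfz_neq0.
by rewrite (valM v_val) ?expfz_neq0 // (valXz v_val) // vt intz subrr.
Qed.

End ExtensionOfValuations.

Lemma valuation_extension (K L : fieldType) (i : {rmorphism K -> L}) (v : K -> int) :
  discrete_valuation v -> algebraic_ext i ->
  exists w : L -> rat, is_valuation w /\ extends_val i v w.
Proof.
move=> dv ai; have [_ [t [t0 vt]]] := dv.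
exact: (@valuation_extension_aux K L i v dv ai t).
Qed.

(** * Algebraic and simple Galois extensions *)

Lemma fieldExt_algebraic (F : fieldType) (L : fieldExtType F) :
  algebraic_ext (in_alg L).
Proof.
move=> y; have /polyOver1P [p pE] := minPolyOver 1%AS y.
exists p; rewrite -pE root_minPoly; split=> //.
apply/eqP => p0; have := monic_neq0 (monic_minPoly 1%AS y).
by rewrite pE p0 map_poly0 eqxx.
Qed.

Lemma algebraic_ext_comp (K E L : fieldType) (i : {rmorphism K -> E})
    (j : {rmorphism E -> L}) :
  algebraic_ext i -> algebraic_ext j -> algebraic_ext (j \o i).
Proof.
move=> ai aj y.
have intE x : integralOver (j \o i) (j x).
  apply/integral_algebraic; have [p [p0 px]] := ai x; exists p => //.
  by rewrite map_poly_comp -[j x]/(j x) fmorph_root.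
have [p [p0 py]] := aj y.
suff /integral_algebraic [r r0 ry] : integralOver (j \o i) y.
  by exists r; split.
apply: (integral_root (p := map_poly j p)) => //; first by rewrite map_poly_eq0.
by move=> x /(nthP 0) [k _ <-]; rewrite coef_map; exact: intE.
Qed.

(** By hypothesis the root field F[X]/(g) already splits g, so it is a splitting field of a
    separable polynomial. *)
Lemma simple_galois_extension (F : fieldType) (g : {poly F}) :
  irreducible_poly g -> separable_poly g ->
  (forall (L : fieldExtType F) (z : L), root (map_poly (in_alg L) g) z ->
     exists rs : seq L, map_poly (in_alg L) g %= \prod_(r <- rs) ('X - r%:P)) ->
  exists (L : splittingFieldType F) (z : L),
    [/\ root (map_poly (in_alg L) g) z, <<1; z>>%VS = fullv,
        \dim {:L} = (size g).-1 & galois 1 {:L}].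
Proof.
move=> irr_g sep_g splits.
have [L dimL [z rz zL]] := irredp_FAdjoin irr_g.
have [rs grs] := splits L z rz.
have gL : splittingFieldFor 1 (map_poly (in_alg L) g) {:L}.
  exists rs => //; apply/eqP; rewrite eqEsubv subvf -zL.
  apply/FadjoinP; split; first exact: subv_adjoin_seq.
  apply: seqv_sub_adjoin; move: rz.
  by rewrite (eqp_root grs) root_prod_XsubC.
have ax : splitting_field_axiom L.
  by exists (map_poly (in_alg L) g) => //; apply/polyOver1P; exists g.
pose SL : splittingFieldType F :=
  HB.pack (FieldExt.sort L) (FieldExt_isSplittingField.Build F L ax).
exists SL, z; split=> //; apply/splitting_galoisField.
exists (map_poly (in_alg L) g); split=> //; first by apply/polyOver1P; exists g.
by rewrite separable_map.
Qed.

(** * Automorphisms of prime order and surjectivity of their norms *)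

Section PrimeOrderAutomorphism.

Variables (F : fieldType) (M : splittingFieldType F).

Lemma gal_expE (x : gal_of {:M}) k y : (x ^+ k)%g y = iter k x y.
Proof.
elim: k => [|k IH]; first by rewrite expg0 gal_id.
by rewrite expgSr galM ?memvf //= IH.
Qed.

(** Cauchy's theorem gives [tau] of order p. Its fixed field H is algebraic over F, so its Brauer
    group is trivial, and M is cyclic of degree p over H. Speaking of [tau]-fixed elements of M
    keeps H out of the statement. *)
Lemma dim_le1_norm (p : nat) (z : M) :
  dim_le1 F -> prime p -> galois 1 {:M} -> <<1; z>>%VS = fullv ->
  (p %| \dim {:M})%N ->
  exists tau : {rmorphism M -> M},
  [/\ forall c : F, tau c%:A = c%:A,
      forall x, iter p tau x = x,
      forall i, (0 < i < p)%N -> iter i tau z != z,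
      forall a, a != 0 -> tau a = a -> exists b, \prod_(i < p) iter i tau b = a &
      forall x, exists P : {poly M},
        [/\ (size P <= p)%N, forall k, tau P`_k = P`_k & x = P.[z]]].
Proof.
move=> dimF p_pr galM zM pd.
have pG : (p %| #|'Gal({:M} / 1)%g|)%N.
  by rewrite -(galois_dim galM) dimv1 divn1.
have [x xG ox] := Cauchy p_pr pG.
pose tau : {rmorphism M -> M} := gal_repr x.
have tauF (c : F) : tau c%:A = c%:A by rewrite [LHS]linearZ /= rmorph1.
have taup y : iter p tau y = y by rewrite -gal_expE -ox expg_order gal_id.
have tau_poly i (P : {poly F}) y : iter i tau (map_poly (in_alg M) P).[y] =
    (map_poly (in_alg M) P).[iter i tau y].
  elim: i => //= i ->; rewrite -horner_map -map_poly_comp.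
  by congr (_.[_]); apply: eq_map_poly => c; rewrite /= tauF.
have tauz i : (0 < i < p)%N -> iter i tau z != z.
  case/andP=> i0 ip; apply/eqP => tz.
  have : (x ^+ i == 1)%g.
    apply/gal_eqP => y _; rewrite gal_expE gal_id.
    have : y \in <<1; z>>%VS by rewrite zM memvf.
    case/Fadjoin_polyP => P /polyOver1P [P0 ->] ->.
    by rewrite [LHS]tau_poly tz.
  by rewrite -order_dvdn ox gtnNdvd.
pose H : {subfield M} := fixedField_aspace <[x]>%g.
have HP y : (y \in H) <-> tau y = y.
  split=> [/mem_fixedFieldP [_]|ty]; first by apply; exact: cycle_id.
  apply/fixedFieldP; rewrite ?memvf // => _ /cycleP [k ->].
  by rewrite gal_expE; elim: k => //= k ->.
have dimH : \dim_H {:M} = p by rewrite -dim_fixedField -orderE ox.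
have dimMH : \dim {: fieldOver H} = p.
  rewrite -dimH -[RHS](dim_aspaceOver (E := {:M}%AS)) ?subvf //; congr (\dim _).
  apply/vspaceP => y; rewrite memvf; apply/esym.
  by rewrite mem_aspaceOver ?subvf //; exact: memvf.
have p_gt0 := prime_gt0 p_pr.
exists tau; split=> //.
- move=> a a0 ta; have aH : a \in H by apply/HP.
  have br : brauer_trivial (subvs_of H).
    exact: (dimF _ (in_alg (subvs_of H))) (@fieldExt_algebraic _ _).
  pose tH : {rmorphism fieldOver H -> fieldOver H} := tau.
  have := @brauer_trivial_norm _ (fieldOver H) tH p.-1 (Subvs aH) br.
  rewrite prednK //; case=> //.
  + by move=> [c cH]; rewrite fieldOver_scaleE mulr1; apply/HP.
  + by move=> i ip; exists z; exact: tauz.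
  + by move=> y /HP yH; exists (Subvs yH); rewrite fieldOver_scaleE mulr1.
  + by move=> b bP; exists b; rewrite bP fieldOver_scaleE mulr1.
- move=> y; exists (Fadjoin_poly H z y); split.
  + apply: leq_trans (size_Fadjoin_poly _ _ _) _.
    rewrite -dimH adjoin_degreeE leq_div2r //.
    by rewrite dimvS // subvf.
  + by move=> k; apply/HP; apply: (polyOverP (Fadjoin_polyOver _ _ _)).
  + rewrite Fadjoin_poly_eq //.
    have: y \in <<1; z>>%VS by rewrite zM memvf.
    by apply: subvP; apply: adjoinSl; apply: sub1v.
Qed.

End PrimeOrderAutomorphism.

(** * Unramified extensions generated by roots of unity *)

Section RootsOfUnityDifferences.

Variables (G : realDomainType) (M : fieldType) (w : M -> G) (N : nat).
Hypothesis w_val : is_valuation w.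
Hypothesis N0 : N%:R != 0 :> M.
Hypothesis wN : w N%:R = 0.

Let N_gt0 : (0 < N)%N.
Proof. by rewrite lt0n; apply: contraNneq N0 => ->. Qed.

Lemma unity_root_neq0 (x : M) : x ^+ N = 1 -> x != 0.
Proof.
by apply: contra_eqN => /eqP->; rewrite expr0n eqn0Ngt N_gt0 eq_sym oner_eq0.
Qed.

Lemma val_unity_root x : x ^+ N = 1 -> w x = 0.
Proof.
move=> xN; have := valX w_val N (unity_root_neq0 xN).
rewrite xN (val1 w_val) => /esym/eqP; rewrite mulrn_eq0.
by rewrite eqn0Ngt N_gt0 /= => /eqP.
Qed.

(* If u is a root of unity with u = 1 modulo the maximal ideal, then
   0 = 1 + u + ... + u^(N-1) = N modulo the maximal ideal. *)
Lemma val_unity_root_diff x y : x ^+ N = 1 -> y ^+ N = 1 -> x != y -> w (x - y) = 0.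
Proof.
move=> xN yN xy; have x0 := unity_root_neq0 xN; have y0 := unity_root_neq0 yN.
have xy0 : x - y != 0 by rewrite subr_eq0.
have ge0 z : z ^+ N = 1 -> val_ge w 0 z.
  by move=> zN; rewrite /val_ge (val_unity_root zN) lexx orbT.
have := val_geB w_val (ge0 _ xN) (ge0 _ yN).
rewrite /val_ge (negbTE xy0) /= le_eqVlt => /orP [/eqP->//|gt0].
pose u := y / x; have uN : u ^+ N = 1 by rewrite expr_div_n xN yN divr1.
have u1 : u - 1 != 0.
  by rewrite subr_eq0; apply: contraNneq xy => u1; rewrite -[y](mulfVK x0) -/u u1 mul1r.
have gtu : val_gt w 0 (u - 1).
  have -> : u - 1 = (x - y) * (- x^-1).
    by rewrite mulrN mulrBl opprB mulfV.
  rewrite -[0 : G]addr0; apply: (val_gtM w_val).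
    by rewrite /val_gt gt0 orbT.
  by rewrite val_geN //; apply: ge0; rewrite exprVn xN invr1.
have gtui i : val_gt w 0 (u ^+ i - 1).
  rewrite subrX1 -[0 : G]addr0; apply: (val_gtM w_val) => //.
  by apply: val_ge_sum => // j _; apply: val_ge0X => //; apply: ge0.
have sum0 : \sum_(i < N) u ^+ i = 0.
  by apply: (mulfI u1); rewrite mulr0 -subrX1 uN subrr.
have : val_gt w 0 (\sum_(i < N) (u ^+ i - 1)).
  by apply: val_gt_sum.
rewrite sumrB sum0 sumr_const card_ord sub0r val_gtN // /val_gt.
by rewrite (negbTE N0) wN ltxx.
Qed.

End RootsOfUnityDifferences.

Section Interpolation.

Variables (G : realDomainType) (M : fieldType) (w : M -> G).
Hypothesis w_val : is_valuation w.

(** Newton interpolation: with P - P(z) = Q (X - z), the values Q(y) = (P(y) - P(z)) / (y - z) at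
    the other nodes obey the same bound, since y - z has value 0. *)
Lemma val_ge_coef_interpolation (c : G) (zs : seq M) : forall P : {poly M},
  (forall z, z \in zs -> val_ge w 0 z) ->
  pairwise (fun x y => (x - y != 0) && (w (x - y) == 0)) zs ->
  (size P <= size zs)%N -> (forall z, z \in zs -> val_ge w c P.[z]) ->
  forall k, val_ge w c P`_k.
Proof.
elim: zs => [|z zs IH] P zs0 /=.
  by rewrite leqn0 size_poly_eq0 => _ /eqP-> _ k; rewrite coef0 /val_ge eqxx.
case/andP=> /allP zP zsP szP cP.
have [Q PQ] : exists Q, P - P.[z]%:P = Q * ('X - z%:P).
  by apply/factor_theorem; rewrite /root !hornerE subrr.
have z_in : z \in z :: zs by rewrite mem_head.
have cQ k : val_ge w c Q`_k.
  apply: IH k => // [y yz||y yz].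
  - by apply: zs0; rewrite inE yz orbT.
  - have [->|Q0] := eqVneq Q 0; first by rewrite size_poly0.
    have szQ : size (Q * ('X - z%:P)) = (size Q).+1.
      by rewrite size_Mmonic ?monicXsubC // size_XsubC addn2.
    rewrite -ltnS -szQ -PQ.
    apply: leq_trans (size_polyD _ _) _; rewrite size_polyN geq_max szP.
    by apply: leq_trans (size_polyC_leq1 _) _.
  have /andP [zy0 /eqP wzy] := zP y yz.
  have yz0 : y - z != 0 by rewrite -opprB oppr_eq0.
  have -> : Q.[y] = (P.[y] - P.[z]) * (y - z)^-1.
    have /(congr1 (fun R => R.[y])) := PQ; rewrite !hornerE => ->.
    by rewrite mulfK.
  rewrite -[c]addr0; apply: (val_geM w_val).
    by apply: (val_geB w_val); apply: cP; rewrite ?z_in // inE yz orbT.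
  by rewrite /val_ge (valV w_val) // -opprB valN // wzy oppr0 lexx orbT.
have -> : P = P.[z]%:P + Q * ('X - z%:P) by rewrite -PQ addrC subrK.
move=> k; rewrite coefD mulrBr coefB coefMX coefMC coefC; apply: (val_geD w_val).
  by case: eqP => // _; [apply: cP|rewrite /val_ge eqxx].
apply: (val_geB w_val); first by case: eqP => // _; rewrite /val_ge eqxx.
by rewrite -[c]addr0; apply: (val_geM w_val) => //; apply: zs0.
Qed.

End Interpolation.

Section IndivisibleUnramified.

Variables (K : fieldType) (v : K -> int) (E : fieldType) (iE : {rmorphism K -> E}).
Variables (w : E -> rat) (M : splittingFieldType E) (p N : nat) (z : M).
Hypothesis v_disc : discrete_valuation v.
Hypothesis v_hens : henselian v.
Hypothesis iE_alg : algebraic_ext iE.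
Hypothesis w_val : is_valuation w.
Hypothesis w_ext : extends_val iE v w.
Hypothesis E_dim1 : dim_le1 E.
Hypothesis p_pr : prime p.
Hypothesis w_indiv : val_indivisible w p.
Hypothesis N0 : N%:R != 0 :> E.
Hypothesis wN : w N%:R = 0.
Hypothesis M_gal : galois 1 {:M}.
Hypothesis zM : <<1; z>>%VS = fullv.
Hypothesis zN : z ^+ N = 1.

Local Notation iM := (in_alg M \o iE).

Let iM_alg : algebraic_ext iM.
Proof. exact: algebraic_ext_comp iE_alg (@fieldExt_algebraic _ M). Qed.

Lemma val_restrict (w0 : M -> rat) : is_valuation w0 -> extends_val iM v w0 ->
  forall c : E, c != 0 -> w0 c%:A = w c.
Proof.
move=> w0_val w0_ext.
apply: (@v_hens E iE iE_alg (fun c => w0 c%:A) w) => //.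
split=> [x y x0 y0|x y x0 y0 xy0].
  by rewrite -[LHS]/(w0 (in_alg M (x * y))) rmorphM (valM w0_val) ?fmorph_eq0.
have := proj2 w0_val (in_alg M x) (in_alg M y).
by rewrite -rmorphD !fmorph_eq0; apply.
Qed.

Lemma val_automorphism (w0 : M -> rat) (s : {rmorphism M -> M}) :
  is_valuation w0 -> extends_val iM v w0 -> (forall c : E, s c%:A = c%:A) ->
  forall y, y != 0 -> w0 (s y) = w0 y.
Proof.
move=> w0_val w0_ext sE.
apply: (@v_hens M iM iM_alg (w0 \o s) w0) => //; last first.
  by move=> x x0; rewrite /= [s _]sE; exact: w0_ext.
split=> [x y x0 y0|x y x0 y0 xy0] /=.
  by rewrite rmorphM (valM w0_val) ?fmorph_eq0.
by rewrite rmorphD; apply: (proj2 w0_val); rewrite -?rmorphD fmorph_eq0.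
Qed.

(** Otherwise surjectivity of the norm and unramifiedness would make the values of the [tau]-fixed
    elements p-divisible among themselves. Dividing often enough and then taking the norm from M to
    E would make every value of E divisible by p in w(E). *)
Lemma prime_not_dvd_dim : ~~ (p %| \dim {:M})%N.
Proof.
apply/negP => pd.
have [w0 [w0_val w0_ext]] := valuation_extension v_disc iM_alg.
have w0E := val_restrict w0_val w0_ext.
have [tau [tauE taup tauz tau_norm tau_gen]] := dim_le1_norm E_dim1 p_pr M_gal zM pd.
have w0tau := val_automorphism w0_val w0_ext tauE.
have iter0 i y : (iter i tau y == 0) = (y == 0).
  by elim: i => //= i <-; rewrite fmorph_eq0.
have w0iter i y : y != 0 -> w0 (iter i tau y) = w0 y.
  by move=> y0; elim: i => //= i <-; rewrite w0tau ?iter0.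
have iterN i : iter i tau z ^+ N = 1.
  by elim: i => //= i IH; rewrite -rmorphXn IH rmorph1.
have N0M : N%:R != 0 :> M by rewrite -(rmorph_nat (in_alg M)) fmorph_eq0.
have wNM : w0 N%:R = 0.
  by rewrite -(rmorph_nat (in_alg M)) /= w0E.
(* Write y = P(z) with [tau]-fixed coefficients. Interpolation at the conjugates of z shows that no
   coefficient has value below that of y; they cannot all have a larger value, so one of them has
   exactly the value of y. *)
have unram y : y != 0 -> exists2 a, a != 0 & tau a = a /\ w0 a = w0 y.
  move=> y0; have [P [szP tauP yP]] := tau_gen y.
  pose zs := [seq iter j tau z | j <- iota 0 p].
  have P_iter j : P.[iter j tau z] = iter j tau y.
    rewrite yP; elim: j => //= j <-; rewrite -horner_map; congr (_.[_]).
    by apply/polyP => k; rewrite coef_map /= tauP.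
  have coefP k : val_ge w0 (w0 y) P`_k.
    apply: (val_ge_coef_interpolation w0_val (zs := zs)).
    - move=> _ /mapP [j _ ->].
      by rewrite /val_ge (val_unity_root w0_val N0M (iterN j)) lexx orbT.
    - rewrite pairwise_map; apply: (sub_in_pairwise (P := [in iota 0 p]) (r := ltn)).
        move=> j l jp lp /= jl; move: (jp : j \in iota 0 p) (lp : l \in iota 0 p).
        rewrite !mem_iota /= add0n => {}jp {}lp.
        suff zjl : iter j tau z != iter l tau z.
          rewrite subr_eq0 zjl /=.
          by rewrite (val_unity_root_diff w0_val N0M wNM (iterN j) (iterN l)).
        apply: contraNneq (tauz (l - j)%N _); last first.
          by rewrite subn_gt0 jl (leq_ltn_trans (leq_subr _ _)).
        rewrite -{1}(subnK (ltnW jl)) addnC iterD => zjl.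
        have inj k' : injective (iter k' tau) by elim: k' => //= k' IH x1 x2 /fmorph_inj/IH.
        by rewrite eq_sym; apply/eqP; apply: inj zjl.
      + by apply/allP.
      + by rewrite -sorted_pairwise ?iota_ltn_sorted //; exact: ltn_trans.
    - by rewrite size_map size_iota.
    - by move=> _ /mapP [j _ ->]; rewrite P_iter /val_ge w0iter // lexx orbT.
  have [[k [Pk0 wPk]]|noP] := pselect (exists k, P`_k != 0 /\ w0 P`_k = w0 y).
    by exists P`_k => //; rewrite tauP.
  have : val_gt w0 (w0 y) y.
    rewrite {2}yP horner_coef; apply: val_gt_sum => // k _.
    rewrite -[w0 y]addr0; apply: (val_gtM w0_val); last first.
      by apply: val_ge0X => //; rewrite /val_ge (val_unity_root w0_val N0M zN) lexx orbT.
    move: (coefP k); rewrite /val_ge /val_gt; have [//|Pk0 /=] := eqVneq P`_k 0.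
    rewrite le_eqVlt => /orP [/eqP wPk|//].
    by case: noP; exists k.
  by rewrite /val_gt (negbTE y0) ltxx.
have div a : a != 0 -> tau a = a ->
    exists2 b, b != 0 & tau b = b /\ w0 a = p%:R * w0 b.
  move=> a0 ta; have [b ab] := tau_norm a a0 ta.
  have b0 : b != 0.
    apply: contraNneq a0 => b0; rewrite -ab (bigD1 (Ordinal (prime_gt0 p_pr))) //=.
    by rewrite b0 mul0r.
  have [b' b'0 [tb' wb']] := unram b b0; exists b' => //; split=> //.
  rewrite -ab (val_prod w0_val); last by move=> i; rewrite iter0.
  rewrite (eq_bigr (fun=> w0 b)); last by move=> i _; rewrite w0iter.
  by rewrite sumr_const card_ord wb' mulr_natl.
have [x [x0 xP]] := w_indiv.
(* With [M : E] = p^k n' and n' prime to p, dividing k+1 times leaves one factor p after the norm to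
   E: n' w(x) = p w(y). *)
have [b b0 xb] : exists2 b, b != 0 &
    w0 x%:A = (p ^ (logn p (\dim {:M})).+1)%:R * w0 b.
  suff [b b0 [_ xb]] : exists2 b, b != 0 &
    tau b = b /\ w0 x%:A = (p ^ (logn p (\dim {:M})).+1)%:R * w0 b by exists b.
  elim: (_.+1) => [|k [b b0 [tb xb]]].
    exists x%:A; first by rewrite -[x%:A]/(in_alg M x) fmorph_eq0.
    by rewrite tauE expn0 mul1r.
  have [b' b'0 [tb' wb']] := div b b0 tb; exists b' => //; split=> //.
  by rewrite xb wb' mulrA -natrM -expnSr.
have dM0 : (0 < \dim {:M})%N by exact: adim_gt0.
have [n' pn' dimE] := pfactor_coprime p_pr dM0.
have /vlineP [y yE] := mem_galNorm M_gal (memvf b).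
have Nb0 : galNorm 1 {:M} b != 0 by rewrite galNorm_eq0.
have y0 : y != 0 by apply: contraNneq Nb0 => y0; rewrite yE y0 scale0r.
have wy : w y = (\dim {:M})%:R * w0 b.
  rewrite -w0E // -yE /galNorm -big_enum (val_prod w0_val); last first.
    by move=> s; rewrite fmorph_eq0.
  rewrite (eq_bigr (fun=> w0 b)); last first.
    move=> s _; apply: (val_automorphism (s := gal_repr s)) => // c.
    by rewrite [LHS]linearZ /= rmorph1.
  by rewrite big_enum sumr_const -(galois_dim M_gal) dimv1 divn1 mulr_natl.
have key : n'%:R * w x = p%:R * w y.
  rewrite -w0E // xb wy {2}dimE !mulrA -!natrM; congr (_%:R * _).
  by rewrite expnS mulnC -!mulnA [(p ^ _ * n')%N]mulnC.
have n'0 : (0 < n')%N.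
  by case: (n') dimE dM0 => // ->.
(* From u n' = t p + 1 follows w(x) = p (u w(y) - t w(x)), the value of (y^u x^-t)^p. *)
have [u t ut _] := egcdnP p n'0; move: pn'; rewrite coprime_sym => /eqP n'p.
rewrite n'p in ut.
have zf : y ^+ u * x ^- t != 0 by rewrite mulf_neq0 ?invr_eq0 ?expf_neq0.
have /eqP := xP _ zf; apply.
rewrite (valM w_val) ?invr_eq0 ?expf_neq0 // (valV w_val) ?expf_neq0 //.
rewrite !(valX w_val) // -[w y *+ u]mulr_natl -[w x *+ t]mulr_natl mulrBr.
rewrite [p%:R * (u%:R * _)]mulrCA -key mulrA -natrM ut natrD natrM mulrDl mul1r.
by rewrite [p%:R * (t%:R * _)]mulrCA [t%:R * (p%:R * _)]mulrA [X in X - _]addrC addrK.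
Qed.

End IndivisibleUnramified.

(** * Irreducible polynomials and common roots *)

Section IrreduciblePolynomials.

Lemma irreducible_dvd_common_root (F L : fieldType) (i : {rmorphism F -> L})
    (g h : {poly F}) (z : L) :
  irreducible_poly g -> root (map_poly i g) z -> root (map_poly i h) z -> g %| h.
Proof.
case=> _ irr gz hz; have sz1 : size (gcdp g h) != 1%N.
  apply/negP => /size_poly1P [c c0 gc].
  have : root (map_poly i (gcdp g h)) z by rewrite gcdp_map root_gcd gz.
  by rewrite gc map_polyC rootC fmorph_eq0 (negbTE c0).
have := irr _ sz1 (dvdp_gcdl g h) => /andP [_ /dvdp_trans]; apply.
exact: dvdp_gcdr.
Qed.

Lemma exists_irreducible_factor (F : fieldType) (f : {poly F}) :
  (1 < size f)%N -> exists g, irreducible_poly g /\ g %| f.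
Proof.
have [n] := ubnP (size f); elim: n f => // n IH f; rewrite ltnS => fn f1.
have [irr|red] := pselect (irreducible_poly f); first by exists f.
have f0 : f != 0 by rewrite -size_poly_gt0 ltnW.
have [h [h1 hf nhf]] : exists h : {poly F}, [/\ size h != 1%N, h %| f & ~~ (h %= f)].
  apply: contrapT => noh; apply: red; split=> // h h1 hf; apply: contrapT => nhf.
  by apply: noh; exists h; split=> //; apply/negP.
have h0 : h != 0 by apply: contraNneq f0 => h0; rewrite -dvd0p -h0.
have hs : (size h < size f)%N.
  rewrite ltn_neqAle dvdp_leq // andbT; apply: contra nhf => /eqP sz.
  by rewrite -dvdp_size_eqp // sz.
have [||g [irr gh]] := IH h.
- exact: leq_trans hs fn.
- by move: h0 h1; rewrite -size_poly_gt0; case: (size h) => [|[]].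
- by exists g; split=> //; exact: dvdp_trans hf.
Qed.

End IrreduciblePolynomials.

(** * The Frobenius map on elements algebraic over a finite field *)

Section FiniteCharacteristic.

Variables (L : fieldType) (q : nat).
Hypothesis qL : q \in [pchar L].

Let q_pr : prime q := pcharf_prime qL.
Local Notation Frob := (pFrobenius_aut qL).

Lemma FrobE n x : iter n Frob x = x ^+ (q ^ n).
Proof.
elim: n => [|n IH] /=; first by rewrite expn0 expr1.
by rewrite IH pFrobenius_autE -exprM -expnSr.
Qed.

Lemma exp_charX_inj n : injective (fun x : L => x ^+ (q ^ n)).
Proof.
move=> x y /=; rewrite -!FrobE; elim: n => //= n IH /fmorph_inj; exact: IH.
Qed.

(** There are finitely many remainders modulo an equation of a, so two of the powers a^(q^n)
    coincide; injectivity of Frobenius cancels the smaller exponent. *)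
Lemma algebraic_finite_frobenius (k : finFieldType) (i : {rmorphism k -> L}) (a : L) :
  integralOver i a -> exists2 m, (0 < m)%N & a ^+ (q ^ m) = a.
Proof.
case=> h h_monic ha.
pose d := (size h).-1.
have rem_size n : (size ('X^n %% h : {poly k})%R <= d)%N.
  by rewrite -ltnS prednK ?size_poly_gt0 ?ltn_modp monic_neq0.
pose f (n : 'I_(#|'rV[k]_d|).+1) : 'rV[k]_d := poly_rV ('X^(q ^ n) %% h).
have /injectivePn [n1 [n2 n12 f12]] : ~~ injectiveb f.
  apply/negP => /injectiveP /leq_card; rewrite card_ord ltnn.
  by [].
have same n : a ^+ n = (map_poly i ('X^n %% h)).[a].
  have := divp_eq 'X^n h => /(congr1 (fun P => (map_poly i P).[a])).
  rewrite map_polyXn hornerXn => ->; rewrite rmorphD rmorphM /= hornerD hornerM.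
  by rewrite (rootP ha) mulr0 add0r.
have e12 : a ^+ (q ^ n1) = a ^+ (q ^ n2).
  rewrite !same; congr (map_poly i _).[a].
  by rewrite -[LHS](poly_rV_K (rem_size _)) -[RHS](poly_rV_K (rem_size _)) -/(f n1) f12.
wlog lt12 : n1 n2 {n12 f12} e12 / (n1 < n2)%N => [wl|].
  have [lt|lt|/val_inj E] := ltngtP n1 n2; first exact: wl lt.
    by apply: wl lt.
  by rewrite E eqxx in n12.
exists (n2 - n1)%N; first by rewrite subn_gt0.
by apply: (@exp_charX_inj n1); rewrite /= -exprM -expnD subnK ?e12 // ltnW.
Qed.

Lemma frobenius_period (a : L) m c : a ^+ (q ^ m) = a -> a ^+ (q ^ (m * c)) = a.
Proof.
move=> am; elim: c => [|c IH]; first by rewrite muln0 expn0 expr1.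
by rewrite mulnS expnD exprM am.
Qed.

(** The q elements of the prime field exhaust the roots of X^q - X. *)
Lemma frobenius_fixed_nat (c : L) : c ^+ q = c -> exists n, c = n%:R.
Proof.
move=> cq; pose rs := [seq n%:R : L | n <- iota 0 q].
have [/mapP [n _ ->]|c_rs] := boolP (c \in rs); first by exists n.
have q1 := prime_gt1 q_pr.
have szXq : size ('X^q - 'X : {poly L}) = q.+1.
  by rewrite size_polyDl ?size_polyXn // size_polyN size_polyX.
have P0 : 'X^q - 'X != 0 :> {poly L} by rewrite -size_poly_gt0 szXq.
have := max_poly_roots P0 (rs := c :: rs); rewrite szXq /= size_map size_iota.
rewrite ltnn => H; suff : false by []. apply: H.
  apply/andP; split; first by rewrite /root !hornerE cq subrr.
  apply/allP => _ /mapP [n _ ->].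
  by rewrite /root !hornerE -(pFrobenius_autE qL) rmorph_nat subrr.
rewrite c_rs /= map_inj_in_uniq ?iota_uniq // => n1 n2.
wlog n12 : n1 n2 / (n1 <= n2)%N => [wl|].
  have [/wl//|/ltnW/wl H'] := leqP n1 n2.
  by move=> i1 i2 e; apply/esym/H'.
rewrite !mem_iota /= add0n => _ n2q e.
have /eqP : (n2 - n1)%:R = 0 :> L by rewrite natrB // e subrr.
rewrite -(dvdn_pcharf qL) => d.
apply/eqP; rewrite eqn_leq n12 -subn_eq0 /= eqn0Ngt; apply/negP => gt0.
by have := dvdn_leq gt0 d; rewrite leqNgt (leq_ltn_trans (leq_subr _ _)).
Qed.

(* The linear forms a_i + z_i T, rather than a_i and z_i separately, are used
   in order to get the same exponent j for both elements. *)
Lemma frobenius_conjugate (s : {rmorphism L -> L}) (a z : L) m :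
  (0 < m)%N -> a ^+ (q ^ m) = a -> z ^+ (q ^ m) = z ->
  exists j, s a = a ^+ (q ^ j) /\ s z = z ^+ (q ^ j).
Proof.
move=> m0 am zm.
have s_fix c : c ^+ q = c -> s c = c.
  by case/frobenius_fixed_nat => n ->; rewrite rmorph_nat.
pose l j : {poly L} := (a ^+ (q ^ j))%:P + (z ^+ (q ^ j)) *: 'X.
(* Frobenius permutes the forms [l j] cyclically, so P is defined over the prime field and is fixed
   by s; hence s sends the root [l 0] to some root [l j]. *)
pose P : {poly {poly L}} := \prod_(j < m) ('X - (l j)%:P).
have mapPE (t : {rmorphism L -> L}) :
    map_poly (map_poly t) P = \prod_(j < m) ('X - (map_poly t (l j))%:P).
  rewrite rmorph_prod; apply: eq_bigr => j _ /=.
  by rewrite rmorphB /= map_polyX map_polyC.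
have lFrob j : map_poly Frob (l j) = l j.+1.
  rewrite rmorphD /= map_polyC map_polyZ map_polyX /= !pFrobenius_autE.
  by rewrite -!exprM -!expnSr.
have l_m : l m = l 0%N by rewrite /l am zm expn0 !expr1.
have PFrob : map_poly (map_poly Frob) P = P.
  rewrite mapPE (eq_bigr (fun j : 'I_m => 'X - (l j.+1)%:P)); last first.
    by move=> j _; rewrite lFrob.
  rewrite /P; case: (m) m0 l_m => // n _ l_n.
  by rewrite big_ord_recr [RHS]big_ord_recl /= mulrC l_n.
have Ps : map_poly (map_poly s) P = P.
  apply/polyP => k; rewrite coef_map /=; apply/polyP => e; rewrite coef_map /=.
  apply: s_fix; rewrite -(pFrobenius_autE qL).
  by have := congr1 (fun R : {poly {poly L}} => R`_k`_e) PFrob; rewrite !coef_map.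
have : root P (map_poly s (l 0%N)).
  rewrite -Ps mapPE -(big_map (fun j : 'I_m => map_poly s (l j)) xpredT
    (fun y => 'X - y%:P)) root_prod_XsubC.
  by apply/mapP; exists (Ordinal m0); rewrite ?mem_index_enum.
rewrite /P -(big_map (fun j : 'I_m => l j) xpredT (fun y => 'X - y%:P)).
rewrite root_prod_XsubC => /mapP [j _ sl]; exists j.
have coef1 e : (map_poly s (l 0%N))`_e = (l j)`_e by rewrite sl.
split; [have := coef1 0%N|have := coef1 1%N];
  by rewrite coef_map /l !coefD !coefC !coefZ !coefX /= expn0 !expr1
             ?mulr0 ?addr0 ?mulr1 ?add0r.
Qed.

End FiniteCharacteristic.

(** * Automorphisms of order p and roots of unity of p-power order *)

Lemma expn_eq1_gcd (q N i j : nat) : (0 < i)%N ->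
  q ^ i = 1 %[mod N] -> q ^ j = 1 %[mod N] -> q ^ gcdn i j = 1 %[mod N].
Proof.
move=> i0 qi qj; have [u t ut _] := egcdnP j i0.
have : (q ^ (u * i) = q ^ (t * j + gcdn i j) %[mod N])%N by rewrite ut.
rewrite expnD [(u * i)%N]mulnC [(t * j)%N]mulnC !expnM -modnMml.
rewrite -[((q ^ i) ^ u %% N)%N]modnXm qi modnXm exp1n.
by rewrite -[((q ^ j) ^ t %% N)%N]modnXm qj modnXm exp1n modnMml mul1n.
Qed.

(** Let d be the gcd of j and the totient of p^n; then q^d = 1 modulo p^n, and the prime-to-p part
    of d divides p - 1. If p^k did not divide d, then d would divide B = p^k (p - 1), so q^B = 1
    modulo p^n, which is impossible once p^n > q^B; n = q^B is large enough. *)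
Lemma order_large_pfactor (p q k : nat) : prime p -> prime q -> p != q ->
  exists n, forall j, q ^ j = 1 %[mod p ^ n] -> (p ^ k %| j)%N.
Proof.
move=> p_pr q_pr pq; pose B := (p ^ k * p.-1)%N.
have p1 := prime_gt1 p_pr; have q1 := prime_gt1 q_pr.
have p0 := prime_gt0 p_pr.
exists (q ^ B)%N => j qj; apply: contraT => nkj.
have n0 : (0 < q ^ B)%N by rewrite expn_gt0 prime_gt0.
have j0 : (0 < j)%N by rewrite lt0n; apply: contraNneq nkj => ->.
have co : coprime q (p ^ (q ^ B)).
  by rewrite coprimeXr // prime_coprime // dvdn_prime2 // eq_sym.
have qd := expn_eq1_gcd j0 qj (Euler_exp_totient co).
set d := gcdn _ _ in qd.
have d0 : (0 < d)%N by rewrite gcdn_gt0 j0.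
have nkd : ~~ (p ^ k %| d)%N by apply: contra nkj => /dvdn_trans -> //; exact: dvdn_gcdl.
have dB : (d %| B)%N.
  have [d' pd' dE] := pfactor_coprime p_pr d0.
  have lk : (logn p d < k)%N by rewrite ltnNge -pfactor_dvdn.
  rewrite dE mulnC dvdn_mul ?dvdn_exp2l 1?ltnW //.
  have : (d' %| totient (p ^ (q ^ B)))%N.
    by apply: dvdn_trans (dvdn_gcdr j _); rewrite -/d dE dvdn_mulr.
  by rewrite totient_pfactor // Gauss_dvdl // coprimeXr // coprime_sym.
have : q ^ B = 1 %[mod p ^ (q ^ B)].
  move: qd; move: (p ^ (q ^ B))%N => N' qd.
  by case/dvdnP: dB => c ->; rewrite mulnC expnM -modnXm qd modnXm exp1n.
have B0 : (0 < B)%N by rewrite muln_gt0 expn_gt0 p0 /= -subn1 subn_gt0.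
have ltB : (q ^ B < p ^ (q ^ B))%N by exact: ltn_expl.
rewrite !modn_small ?(leq_ltn_trans _ ltB) // => E.
by have := ltn_expl B q1; rewrite E ltnS leqNgt B0.
Qed.

Lemma iter_coprime_fixed (T : Type) (s : T -> T) (x : T) (m p : nat) :
  (0 < m)%N -> coprime m p -> iter m s x = x -> iter p s x = x -> s x = x.
Proof.
move=> m0 co mx px; have [u t ut _] := egcdnP p m0.
have iter_mul n c : iter n s x = x -> iter (c * n) s x = x.
  by move=> nx; elim: c => // c IH; rewrite mulSn iterD IH.
have := iter_mul m u mx; rewrite ut (eqP co) addn1 /=.
by rewrite (iter_mul p t px).
Qed.

(** If s acts on a and z by raising to the power q^j, then s z = z forces the p-part of m to divide
    j. So a is fixed by s^m', where m' is the prime-to-p part of m, as well as by s^p. *)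
Lemma automorphism_fixes_unity (L : fieldType) (q p : nat) (s : {rmorphism L -> L})
    (a : L) (m : nat) :
  q \in [pchar L] -> prime p -> p != q -> (forall x, iter p s x = x) ->
  (0 < m)%N -> a ^+ (q ^ m) = a ->
  (forall n, exists z : L, (p ^ n).-primitive_root z /\ s z = z) -> s a = a.
Proof.
move=> qL p_pr pq sp m0 am unity; have q_pr := pcharf_prime qL.
have p1 := prime_gt1 p_pr.
have [m' pm' mE] := pfactor_coprime p_pr m0.
have [n nP] := order_large_pfactor (logn p m) p_pr q_pr pq.
have [z [zprim sz]] := unity n.
have co : coprime q (p ^ n).
  by rewrite coprimeXr // prime_coprime // dvdn_prime2 // eq_sym.
have t0 : (0 < totient (p ^ n))%N by rewrite totient_gt0 expn_gt0 prime_gt0.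
have zt : z ^+ (q ^ totient (p ^ n)) = z.
  rewrite -[RHS]expr1; apply/eqP; rewrite (eq_prim_root_expr zprim).
  exact/eqP/Euler_exp_totient.
(* The product is a common Frobenius period of a and z. *)
have [|||j [sa sz']] := @frobenius_conjugate L q qL s a z (m * totient (p ^ n)).
- by rewrite muln_gt0 m0.
- exact: frobenius_period.
- by rewrite mulnC; apply: frobenius_period.
have qj : q ^ j = 1 %[mod p ^ n].
  by apply/eqP; rewrite -(eq_prim_root_expr zprim) expr1 -sz' sz.
have /dvdnP [c jE] := nP j qj.
have sia i : iter i s a = a ^+ (q ^ (j * i)).
  elim: i => [|i IH] /=; first by rewrite muln0 expn0 expr1.
  by rewrite IH rmorphXn sa -exprM -expnD mulnS.
have m'0 : (0 < m')%N by case: (m') mE m0 => // ->.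
apply: (iter_coprime_fixed m'0 _ _ (sp a)); first by rewrite coprime_sym.
rewrite sia jE -mulnA [(_ * m')%N]mulnC -mE mulnC.
exact: frobenius_period.
Qed.

(** * Closedness of a field from the triviality of automorphisms of prime order *)

Section ClosedFields.

Variable R : fieldType.

Lemma p_closed_of_automorphisms (p : nat) : prime p ->
  (forall (L : fieldExtType R) (s : {rmorphism L -> L}),
     (forall c : R, s c%:A = c%:A) -> (forall x, iter p s x = x) ->
     forall x, s x = x) ->
  p_closed R p.
Proof.
move=> p_pr auts L k galL dimL; rewrite dimL.
case: k dimL => // k dimL; exfalso.
have pG : (p %| #|'Gal({:L} / 1)%g|)%N.
  by rewrite -(galois_dim galL) dimv1 divn1 dimL expnS dvdn_mulr.
have [x xG ox] := Cauchy p_pr pG.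
have xid : forall y, x y = y.
  apply: (auts L (gal_repr x)) => [c|y].
    by rewrite [LHS]linearZ /= rmorph1.
  by rewrite -gal_expE -ox expg_order gal_id.
have /eqP x1 : (x == 1)%g by apply/gal_eqP => y _; rewrite xid gal_id.
by have := prime_gt1 p_pr; rewrite -ox x1 order1.
Qed.

(** An irreducible factor g of f is separable and its root field is normal, both because elements of
    finite extensions have finite Frobenius orbits. If deg g > 1, the Galois group contains an
    element of prime order, contrary to the hypothesis. *)
Lemma alg_closed_of_automorphisms (q : nat) : q \in [pchar R] ->
  (forall (L : fieldExtType R) (a : L), exists2 m, (0 < m)%N & a ^+ (q ^ m) = a) ->
  (forall p, prime p ->
   forall (L : fieldExtType R) (s : {rmorphism L -> L}),
     (forall c : R, s c%:A = c%:A) -> (forall x, iter p s x = x) ->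
     forall x, s x = x) ->
  alg_closed R.
Proof.
move=> qR algR auts f f1.
have [g [irr_g gf]] := exists_irreducible_factor f1.
suff sz2 : size g = 2%N.
  have [x gx] := poly2_root sz2; exists x; apply: root_dvdp gx => //.
have qL (L : fieldExtType R) : q \in [pchar L] by rewrite pchar_lalg.
have q_gt0 := prime_gt0 (pcharf_prime qR).
have splits (L : fieldExtType R) (z : L) : root (map_poly (in_alg L) g) z ->
    exists rs : seq L, map_poly (in_alg L) g %= \prod_(r <- rs) ('X - r%:P).
  move=> gz; have [m m0 zm] := algR L z.
  (* P is Frobenius-invariant, hence has coefficients in the prime field and so in R; having the
     root z, it is divisible by g, which therefore splits in L. *)
  pose P := \prod_(j < m) ('X - (z ^+ (q ^ j))%:P).
  have PFrob : map_poly (pFrobenius_aut (qL L)) P = P.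
    rewrite /P rmorph_prod (eq_bigr (fun j : 'I_m => 'X - (z ^+ (q ^ j.+1))%:P)).
      case: (m) m0 zm => // n _ zn.
      by rewrite big_ord_recr [RHS]big_ord_recl /= mulrC zn expn0 expr1.
    move=> j _; rewrite rmorphB /= map_polyX map_polyC /= pFrobenius_autE.
    by rewrite -exprM -expnSr.
  have /polyOver1P [P0 PE] : P \is a polyOver 1%VS.
    apply/polyOverP => k.
    have /(frobenius_fixed_nat (qL L)) [n ->] : P`_k ^+ q = P`_k.
      by rewrite -(pFrobenius_autE (qL L)) -{2}PFrob coef_map.
    by apply/vlineP; exists n%:R; rewrite scaler_nat.
  have /(irreducible_dvd_common_root irr_g gz) : root (map_poly (in_alg L) P0) z.
    rewrite -PE /P -(big_map (fun j : 'I_m => z ^+ (q ^ j)) xpredT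
      (fun y => 'X - y%:P)) root_prod_XsubC.
    by apply/mapP; exists (Ordinal m0); rewrite ?mem_index_enum // expn0 expr1.
  rewrite -(dvdp_map (in_alg L)) -PE /P.
  rewrite -(big_map (fun j : 'I_m => z ^+ (q ^ j)) xpredT (fun y => 'X - y%:P)).
  by case/dvdp_prod_XsubC => msk gE; eexists; exact: gE.
have sep_g : separable_poly g.
  have [L _ [z gz _]] := irredp_FAdjoin irr_g; have [m m0 zm] := algR L z.
  have : g %| 'X^(q ^ m) - 'X.
    apply: irreducible_dvd_common_root irr_g gz _.
    by rewrite rmorphB /= map_polyXn map_polyX /root !hornerE zm subrr.
  move/dvdp_separable; apply; rewrite separable_poly.unlock derivB derivXn derivX.
  have qm : (q ^ m)%:R = 0 :> R.
    by apply/eqP; rewrite -(dvdn_pcharf qR) -(prednK m0) expnS dvdn_mulr.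
  rewrite -mulr_natl -polyC_natr qm mul0r sub0r -[X in coprimep _ X]scaleN1r.
  by rewrite coprimepZr ?oppr_eq0 ?oner_eq0 // coprimep1.
have [L [z [gz zL dimL galL]]] := simple_galois_extension irr_g sep_g splits.
have := irr_g.1; rewrite leq_eqVlt => /orP [/eqP->//|sz3]; exfalso.
have G1 : (1 < #|'Gal({:L} / 1)%g|)%N.
  rewrite -(galois_dim galL) dimv1 divn1 dimL.
  by case: (size g) sz3 => [|[|[]]].
have p_pr := pdiv_prime G1.
have [x xG ox] := Cauchy p_pr (pdiv_dvd _).
have xid : forall y, x y = y.
  apply: (auts _ p_pr L (gal_repr x)) => [c|y].
    by rewrite [LHS]linearZ /= rmorph1.
  by rewrite -gal_expE -ox expg_order gal_id.
have /eqP x1 : (x == 1)%g by apply/gal_eqP => y _; rewrite xid gal_id.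
by have := prime_gt1 p_pr; rewrite -ox x1 order1.
Qed.

End ClosedFields.

(** * Reduction of polynomials and Gauss's lemma *)

Section ResiduePolynomials.

Variables (G : realDomainType) (E : fieldType) (w : E -> G).
Variables (R : fieldType) (res : E -> R).
Hypothesis w_val : is_valuation w.
Hypothesis res_map : residue_map w res.

Lemma resD x y : val_ge w 0 x -> val_ge w 0 y -> res (x + y) = res x + res y.
Proof. by case: res_map => + _ _ _ _ => /[swap] /val_ge0E + /[swap] /val_ge0E; auto. Qed.

Lemma resM x y : val_ge w 0 x -> val_ge w 0 y -> res (x * y) = res x * res y.
Proof. by case: res_map => _ + _ _ _ => /[swap] /val_ge0E + /[swap] /val_ge0E; auto. Qed.

Lemma res1 : res 1 = 1. Proof. by case: res_map. Qed.

Lemma res_surj r : exists2 x, val_ge w 0 x & res x = r.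
Proof.
by case: res_map => _ _ _ /(_ r) [x [/val_ge0E xv xr]] _; exists x.
Qed.

Lemma res_eq0 x : val_ge w 0 x -> (res x == 0) = val_gt w 0 x.
Proof.
move=> /val_ge0E xv; case: res_map => _ _ _ _ /(_ x xv) [r0 r0'].
apply/eqP/idP => [/r0 /val_gt0E //|]; by move=> /val_gt0E /r0'.
Qed.

Lemma val_ge00 : val_ge w 0 0. Proof. by rewrite /val_ge eqxx. Qed.

Lemma res0 : res 0 = 0.
Proof. by apply/eqP; rewrite res_eq0 ?val_ge00 // /val_gt eqxx. Qed.

Lemma resN x : val_ge w 0 x -> res (- x) = - res x.
Proof.
move=> xv; apply/eqP; rewrite -addr_eq0 -resD ?val_geN // addNr res0 //.
Qed.

Lemma resB x y : val_ge w 0 x -> val_ge w 0 y -> res (x - y) = res x - res y.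
Proof. by move=> xv yv; rewrite resD ?val_geN // resN. Qed.

Lemma res_unit x : x != 0 -> w x = 0 -> res x != 0.
Proof.
move=> x0 wx; rewrite res_eq0; first by rewrite /val_gt (negbTE x0) wx ltxx.
by rewrite /val_ge wx lexx orbT.
Qed.

Lemma val_eq0_res x : val_ge w 0 x -> res x != 0 -> x != 0 /\ w x = 0.
Proof.
move=> xv; rewrite res_eq0 // /val_gt negb_or => /andP [x0]; rewrite -leNgt => wx.
by move: xv; rewrite /val_ge (negbTE x0) /= => wx'; split=> //; apply/eqP; rewrite eq_le wx.
Qed.

Lemma res_nat n : res n%:R = n%:R.
Proof.
elim: n => [|n IH]; first exact: res0.
by rewrite -!natr1 resD ?IH ?res1 ?val_ge_nat ?val_ge01.
Qed.

Lemma val_ge0M x y : val_ge w 0 x -> val_ge w 0 y -> val_ge w 0 (x * y).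
Proof. by move=> xv yv; rewrite -[0 : G]addr0; apply: val_geM. Qed.

Lemma resX x n : val_ge w 0 x -> res (x ^+ n) = res x ^+ n.
Proof.
move=> xv; elim: n => [|n IH]; first by rewrite !expr0 res1.
by rewrite !exprS resM ?val_ge0X // IH.
Qed.

Lemma res_sum (I : Type) (r : seq I) (P : pred I) (f : I -> E) :
  (forall i, val_ge w 0 (f i)) ->
  res (\sum_(i <- r | P i) f i) = \sum_(i <- r | P i) res (f i).
Proof.
move=> fv; elim: r => [|i r IH]; first by rewrite !big_nil res0.
rewrite !big_cons; case: ifP => // _; rewrite resD ?IH //.
exact: val_ge_sum.
Qed.

Definition integral_coefs (P : {poly E}) : Prop := forall k, val_ge w 0 P`_k.

Local Notation resp := (map_poly res).

Lemma coef_resp P k : (resp P)`_k = res P`_k.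
Proof. exact: coef_map_id0 res0. Qed.

Lemma integral_coefsM P Q :
  integral_coefs P -> integral_coefs Q -> integral_coefs (P * Q).
Proof.
by move=> Pv Qv k; rewrite coefM; apply: val_ge_sum => // j _; apply: val_ge0M.
Qed.

Lemma integral_coefsXsubC x : val_ge w 0 x -> integral_coefs ('X - x%:P).
Proof.
move=> xv k; rewrite coefB coefX coefC; apply: (val_geB w_val).
  exact: val_ge_nat.
by case: ifP => // _; exact: val_ge00.
Qed.

Lemma respM P Q : integral_coefs P -> integral_coefs Q -> resp (P * Q) = resp P * resp Q.
Proof.
move=> Pv Qv; apply/polyP => k; rewrite coef_resp !coefM res_sum; last first.
  by move=> j; apply: val_ge0M.
by apply: eq_bigr => j _; rewrite !coef_resp resM.
Qed.

Lemma resp_horner P x : integral_coefs P -> val_ge w 0 x ->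
  res P.[x] = (resp P).[res x].
Proof.
move=> Pv xv; rewrite horner_coef res_sum; last first.
  by move=> k; apply: val_ge0M => //; apply: val_ge0X.
rewrite (horner_coef_wide (n := size P)) ?size_poly //.
by apply: eq_bigr => k _; rewrite coef_resp resM ?resX ?val_ge0X.
Qed.

Lemma respXsubC x : val_ge w 0 x -> resp ('X - x%:P) = 'X - (res x)%:P.
Proof.
move=> xv; apply/polyP => k; rewrite coef_resp !coefB !coefX !coefC.
have cv : val_ge w 0 (if k == 0%N then x else 0) by case: ifP => // _; exact: val_ge00.
by rewrite resB ?val_ge_nat // res_nat; case: ifP => // _; rewrite res0.
Qed.

Lemma integral_coefs_Xn_sub_1 n : integral_coefs ('X^n - 1).
Proof.
by move=> k; rewrite coefB coefXn coef1; apply: (val_geB w_val); exact: val_ge_nat.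
Qed.

Lemma resp_Xn_sub_1 n : resp ('X^n - 1) = 'X^n - 1.
Proof.
apply/polyP => k; rewrite coef_resp !coefB !coefXn !coef1 resB ?val_ge_nat //.
by rewrite !res_nat.
Qed.

Lemma resp_monic P : P \is monic -> resp P \is monic /\ size (resp P) = size P.
Proof.
move=> Pm; have szP : size (resp P) = size P.
  by rewrite size_map_poly_id0 // (monicP Pm) res1 oner_neq0.
by split=> //; apply/monicP; rewrite lead_coefE szP coef_resp -lead_coefE (monicP Pm) res1.
Qed.

Lemma primitive_scaling (P : {poly E}) : P != 0 ->
  exists k, [/\ P`_k != 0, forall j, val_ge w (w P`_k) P`_j,
    integral_coefs ((P`_k)^-1 *: P) & resp ((P`_k)^-1 *: P) != 0].
Proof.
move=> P0.
have [k [Pk0 kmin]] : exists k, P`_k != 0 /\ forall j, val_ge w (w P`_k) P`_j.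
  have sz : ((size P).-1 < size P)%N by rewrite prednK // size_poly_gt0.
  have P_lead : P`_(Ordinal sz) != 0 by rewrite /= -lead_coefE lead_coef_eq0.
  case: (@arg_minP _ G _ (Ordinal sz) [pred i : 'I_(size P) | P`_i != 0]
    (fun i => w P`_i) P_lead) => k Pk kmin.
  exists k; split=> // j; rewrite /val_ge; have [//|Pj0 /=] := eqVneq P`_j 0.
  have js : (j < size P)%N by rewrite ltnNge; apply: contraNN Pj0 => /leq_sizeP ->.
  exact: (kmin (Ordinal js)).
exists k; split=> //.
  move=> j; rewrite coefZ; have := kmin j; rewrite /val_ge mulf_eq0 invr_eq0 (negbTE Pk0) /=.
  have [//|Pj0 /= wj] := eqVneq P`_j 0.
  by rewrite (valM w_val) ?invr_eq0 // (valV w_val) // addrC subr_ge0.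
apply/eqP => /(congr1 (fun Q : {poly R} => Q`_k)); rewrite coef_resp coef0 coefZ mulVf //.
by rewrite res1 => /eqP; rewrite oner_eq0.
Qed.

(* Gauss's lemma: scaled to have unit content, two polynomials have a product
   with unit content, the residue field having no zero divisors. *)
Lemma monic_factor_integral a b : a \is monic -> b \is monic ->
  integral_coefs (a * b) -> integral_coefs a.
Proof.
move=> am bm abv.
have [k [ak0 kmin av' ar]] := primitive_scaling (monic_neq0 am).
have [l [bl0 lmin bv' br]] := primitive_scaling (monic_neq0 bm).
have wk : w a`_k <= 0.
  have := kmin (size a).-1; rewrite -lead_coefE (monicP am) /val_ge oner_eq0 /=.
  by rewrite (val1 w_val).
have wl : w b`_l <= 0.
  have := lmin (size b).-1; rewrite -lead_coefE (monicP bm) /val_ge oner_eq0 /=.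
  by rewrite (val1 w_val).
have [wk0|wk0] := eqVneq (w a`_k) 0; last first.
  (* If [a] has a coefficient of negative value, scaling multiplies the integral product [a * b] by
     an element of positive value, so its reduction would vanish. *)
  have : resp ((a`_k)^-1 *: a * ((b`_l)^-1 *: b)) != 0 by rewrite respM // mulf_neq0.
  case/eqP; apply/polyP => j; rewrite coef_resp coef0; apply/eqP.
  rewrite -scalerAl -scalerAr scalerA coefZ res_eq0; last first.
    rewrite -coefZ -scalerA scalerAr scalerAl; exact: integral_coefsM.
  rewrite -[0 : G]addr0; apply: (val_gtM w_val) (abv j).
  rewrite /val_gt (valM w_val) ?invr_eq0 // !(valV w_val) //.
  by rewrite -[0 : G]addr0 ltr_leD ?orbT // ?oppr_gt0 ?oppr_ge0 // lt_neqAle wk0.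
move=> j; have := av' j; rewrite coefZ /val_ge mulf_eq0 invr_eq0 (negbTE ak0) /=.
have [//|aj0] := eqVneq a`_j 0.
by rewrite (valM w_val) ?invr_eq0 // (valV w_val) // wk0 oppr0 add0r.
Qed.

Lemma monic_dvd_resp g h : g \is monic -> h \is monic ->
  integral_coefs h -> g %| h ->
  exists u, [/\ h = u * g, u \is monic, integral_coefs u, integral_coefs g &
    resp h = resp u * resp g].
Proof.
move=> gm hm hv /dvdpP [u hE]; exists u.
have um : u \is monic by rewrite -(monicMr _ gm) -hE.
have uv : integral_coefs u by apply: (monic_factor_integral um gm); rewrite -hE.
have gv : integral_coefs g.
  by apply: (monic_factor_integral gm um); rewrite mulrC -hE.
by split=> //; rewrite hE respM.
Qed.

End ResiduePolynomials.

(** * The residue field extension *)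

Section ResidueExtension.

Variables (K : fieldType) (v : K -> int) (k : fieldType) (resK : K -> k).
Variables (E : fieldType) (iE : {rmorphism K -> E}) (w : E -> rat).
Variables (R : fieldType) (resE : E -> R).
Hypothesis v_val : is_valuation v.
Hypothesis w_val : is_valuation w.
Hypothesis w_ext : extends_val iE v w.
Hypothesis resK_map : residue_map v resK.
Hypothesis resE_map : residue_map w resE.

Lemma val_ge_ext x : val_ge v 0 x -> val_ge w 0 (iE x).
Proof.
rewrite /val_ge fmorph_eq0; have [//|x0 /=] := eqVneq x 0.
by rewrite w_ext // ler0z.
Qed.

Lemma val_gt_ext x : val_gt v 0 x -> val_gt w 0 (iE x).
Proof.
rewrite /val_gt fmorph_eq0; have [//|x0 /=] := eqVneq x 0.
by rewrite w_ext // ltr0z.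
Qed.

Lemma exists_residue_morphism : exists i : {rmorphism k -> R},
  forall x, val_ge v 0 x -> i (resK x) = resE (iE x).
Proof.
have /choice [f fP] : forall c, exists x, val_ge v 0 x /\ resK x = c.
  by move=> c; have [x xv xc] := res_surj resK_map c; exists x.
pose i c := resE (iE (f c)).
have iP x : val_ge v 0 x -> i (resK x) = resE (iE x).
  move=> xv; have [fv fr] := fP (resK x); apply/eqP; rewrite -subr_eq0.
  rewrite -(resB w_val resE_map) ?val_ge_ext // -rmorphB.
  rewrite (res_eq0 resE_map) ?val_ge_ext ?(val_geB v_val) //.
  apply: val_gt_ext; rewrite -(res_eq0 resK_map) ?(val_geB v_val) //.
  by rewrite (resB v_val resK_map) // fr subrr.
have iB : zmod_morphism i.
  move=> c d; have [cv cr] := fP c; have [dv dr] := fP d.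
  rewrite -{1}cr -{1}dr -(resB v_val resK_map) // iP ?(val_geB v_val) //.
  by rewrite rmorphB (resB w_val resE_map) ?val_ge_ext.
have iM : monoid_morphism i.
  split=> [|c d].
    by rewrite -(res1 resK_map) iP ?(val_ge01 v_val) // rmorph1 (res1 resE_map).
  have [cv cr] := fP c; have [dv dr] := fP d.
  rewrite -{1}cr -{1}dr -(resM resK_map) // iP ?(val_ge0M v_val) //.
  by rewrite rmorphM (resM resE_map) ?val_ge_ext.
pose iA := GRing.isZmodMorphism.Build k R i iB.
pose iMM := GRing.isMonoidMorphism.Build k R i iM.
by exists (HB.pack i iA iMM : {rmorphism k -> R}).
Qed.

(** An equation over K of a lift of r is first scaled to be integral with nonzero reduction; this
    reduction vanishes at r. *)
Lemma residue_algebraic (i : {rmorphism k -> R}) :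
  (forall x, val_ge v 0 x -> i (resK x) = resE (iE x)) ->
  algebraic_ext iE -> algebraic_ext i.
Proof.
move=> iP algE r; have [x xv <-] := res_surj resE_map r.
have [P [P0 Px]] := algE x.
have [l [Pl0 _ Pv Pr]] := primitive_scaling v_val resK_map P0.
exists (map_poly resK ((P`_l)^-1 *: P)); split=> //; set Q := _ *: P in Pv Pr *.
have -> : map_poly i (map_poly resK Q) = map_poly resE (map_poly iE Q).
  apply/polyP => j; rewrite coef_map (coef_resp resK_map).
  by rewrite (coef_resp resE_map) coef_map /= iP.
rewrite /root -(resp_horner w_val resE_map) //; last first.
  by move=> j; rewrite coef_map; apply: val_ge_ext.
by rewrite map_polyZ hornerZ (rootP Px) mulr0 (res0 resE_map).
Qed.

End ResidueExtension.

(** * Conjugate elements and their values *)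

Lemma simple_extension_embedding (K E : fieldType) (iE : {rmorphism K -> E})
    (g : {poly K}) (M : fieldExtType K) (z : M) (y : E) :
  irreducible_poly g -> root (map_poly (in_alg M) g) z -> <<1; z>>%VS = fullv ->
  root (map_poly iE g) y ->
  exists f : {rmorphism M -> E}, f z = y /\ forall c : K, f c%:A = iE c.
Proof.
move=> irr_g gz zM gy.
have /choice [P PE] : forall m : M, exists P : {poly K}, m = (map_poly (in_alg M) P).[z].
  move=> m; have : m \in <<1; z>>%VS by rewrite zM memvf.
  by case/Fadjoin_polyP => P /polyOver1P [P0 ->] ->; exists P0.
have key (A B : {poly K}) : (map_poly (in_alg M) A).[z] = (map_poly (in_alg M) B).[z] ->
    (map_poly iE A).[y] = (map_poly iE B).[y].
  move=> AB; have /(irreducible_dvd_common_root irr_g gz) :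
      root (map_poly (in_alg M) (A - B)) z.
    by rewrite /root rmorphB /= hornerD hornerN AB subrr.
  rewrite -(dvdp_map iE) => /root_dvdp /(_ gy).
  by rewrite /root rmorphB /= hornerD hornerN subr_eq0 => /eqP.
pose f m := (map_poly iE (P m)).[y].
have fB : zmod_morphism f.
  move=> m1 m2; rewrite /f -hornerN -hornerD -rmorphB; apply: key.
  by rewrite -PE rmorphB /= hornerD hornerN -!PE.
have fM : monoid_morphism f.
  split=> [|m1 m2].
    rewrite /f -[RHS](hornerC 1 y) polyC1 -(rmorph1 (map_poly iE)).
    by apply: key; rewrite -PE rmorph1 -polyC1 hornerC.
  rewrite /f -hornerM -rmorphM; apply: key.
  by rewrite -PE rmorphM /= hornerM -!PE.
pose fA := GRing.isZmodMorphism.Build M E f fB.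
pose fMM := GRing.isMonoidMorphism.Build M E f fM.
exists (HB.pack f fA fMM : {rmorphism M -> E}); split=> [|c] /=.
  rewrite /f -[RHS](hornerX y) -(map_polyX iE); apply: key.
  by rewrite -PE map_polyX hornerX.
rewrite /f -[RHS](hornerC _ y) -(map_polyC iE); apply: key.
by rewrite -PE map_polyC hornerC.
Qed.

(** The root field K(z) embeds into E by z -> y and by z -> y'. Pulling w back along both gives two
    extensions of v, which agree at z. *)
Lemma henselian_conjugate_val (K E : fieldType) (v : K -> int)
    (iE : {rmorphism K -> E}) (w : E -> rat) (g : {poly K}) (y y' : E) :
  henselian v -> is_valuation w -> extends_val iE v w -> irreducible_poly g ->
  root (map_poly iE g) y -> root (map_poly iE g) y' -> y != 0 ->
  y' != 0 /\ w y' = w y.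
Proof.
move=> hv w_val w_ext irr_g gy gy' y0.
have [M _ [z gz zM]] := irredp_FAdjoin irr_g.
have [f [fz fK]] := simple_extension_embedding irr_g gz zM gy.
have [f' [fz' fK']] := simple_extension_embedding irr_g gz zM gy'.
have z0 : z != 0 by rewrite -(fmorph_eq0 f) fz.
have pull (h : {rmorphism M -> E}) : (forall c, h c%:A = iE c) ->
    is_valuation (w \o h) /\ extends_val (in_alg M) v (w \o h).
  move=> hK; split; last by move=> x x0; rewrite /= hK w_ext.
  split=> [a b a0 b0|a b a0 b0 ab0] /=.
    by rewrite rmorphM (valM w_val) ?fmorph_eq0.
  by rewrite rmorphD; apply: (proj2 w_val); rewrite -?rmorphD fmorph_eq0.
split; first by rewrite -fz' fmorph_eq0.
have [fv fe] := pull f fK; have [fv' fe'] := pull f' fK'.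
rewrite -fz -fz'.
exact: (hv M (in_alg M) (@fieldExt_algebraic _ M) _ _ fv' fv fe' fe z z0).
Qed.

(** The substitution X -> y X, compared coefficient by coefficient. *)
Lemma coef_prod_XsubC_scale (E : fieldType) (y : E) (r : seq E) k : y != 0 ->
  (\prod_(z <- r) ('X - (z / y)%:P))`_k * y ^+ size r =
  (\prod_(z <- r) ('X - z%:P))`_k * y ^+ k.
Proof.
move=> y0; elim: r k => [|z r IH] k.
  rewrite !big_nil !coef1; case: eqP => [->//|_].
  by rewrite !mul0r.
rewrite !big_cons !mulrBl !coefB ![(_%:P * _)`_k]coefCM !(mulrC 'X) !coefMX /= !mulrBl.
congr (_ - _); last first.
  by rewrite exprS mulrACA mulfVK // -!mulrA IH.
case: k => [|k] /=; first by rewrite !mul0r.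
by rewrite exprS mulrCA IH mulrCA -exprS.
Qed.

(** As h(1) = 0, h is the combination of the X^k - 1 with its own coefficients, and X^P - 1 divides
    X^k - 1 when P divides k. *)
Lemma dvdp_Xn_sub_1 (R : fieldType) (P : nat) (h : {poly R}) :
  (forall k, h`_k != 0 -> (P %| k)%N) -> root h 1 -> 'X^P - 1 %| h.
Proof.
move=> hP /rootP h1.
have -> : h = \sum_(k < size h) h`_k *: ('X^k - 1).
  rewrite (eq_bigr (fun k : 'I_(size h) => h`_k *: 'X^k - (h`_k)%:P)); last first.
    by move=> k _; rewrite scalerBr -mul_polyC -alg_polyC.
  rewrite sumrB -poly_def coefK -rmorph_sum /=.
  suff -> : \sum_(k < size h) h`_k = 0 by rewrite subr0.
  rewrite -[RHS]h1 horner_coef; apply: eq_bigr => k _.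
  by rewrite expr1n mulr1.
rewrite big_seq; apply: (big_ind (fun Q => 'X^P - 1 %| Q)) => [|Q1 Q2|k _].
- exact: dvdp0.
- exact: dvdp_add.
have [->|hk] := eqVneq h`_k 0; first by rewrite scale0r dvdp0.
rewrite dvdpZr //; case/dvdnP: (hP k hk) => c ->.
by rewrite mulnC exprM [X in _ %| X]subrX1 dvdp_mulIl.
Qed.

(** * Roots of unity in the residue field when the value group is p-divisible *)

Section DivisibleValueGroup.

Variables (K : fieldType) (v : K -> int) (E : fieldType) (iE : {rmorphism K -> E}).
Variables (w : E -> rat) (R : fieldType) (resE : E -> R) (p : nat).
Hypothesis v_disc : discrete_valuation v.
Hypothesis v_hens : henselian v.
Hypothesis E_gal : galois_ext iE.
Hypothesis w_val : is_valuation w.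
Hypothesis w_ext : extends_val iE v w.
Hypothesis resE_map : residue_map w resE.
Hypothesis p_pr : prime p.
Hypothesis w_div : ~ val_indivisible w p.
Hypothesis p_R : p%:R != 0 :> R.

Lemma exists_pfactor_val n : exists2 y, y != 0 & (p ^ n)%:R * w y = 1.
Proof.
elim: n => [|n [y y0 wy]].
  have [_ [t [t0 vt]]] := v_disc; exists (iE t); rewrite ?fmorph_eq0 //.
  by rewrite mul1r w_ext // vt.
have [x [x0 xy]] : exists x, x != 0 /\ w y = p%:R * w x.
  apply: contrapT => nox; apply: w_div; exists y; split=> // x x0.
  by apply/eqP => xy; apply: nox; exists x.
by exists x => //; rewrite expnSr natrM -mulrA -xy.
Qed.

(* The conjugates z of an element y of value 1/P have the same value as y.  Up to
   a power of y, the coefficients of prod (X - z/y) lie in K and so have integral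
   values; hence its reduction only involves powers of X^P. *)
Lemma residue_pfactor_unity n : exists z : R, (p ^ n).-primitive_root z.
Proof.
set P := (p ^ n)%N; have P_gt0 : (0 < P)%N by rewrite expn_gt0 prime_gt0.
have [y y0 wy] := exists_pfactor_val n; rewrite -/P in wy.
have [g [irr_g [_ gy]]] := proj1 E_gal y.
have [r gr] := proj2 E_gal g irr_g (ex_intro _ y gy).
have g0 : g != 0 by rewrite -size_poly_gt0 (ltn_trans _ irr_g.1).
have rP z : z \in r -> z != 0 /\ w z = w y.
  move=> zr; apply: (henselian_conjugate_val v_hens w_val w_ext irr_g gy) => //.
  by rewrite (eqp_root gr) root_prod_XsubC.
have yr : y \in r by rewrite -root_prod_XsubC -(eqp_root gr).
pose g1 := (lead_coef g)^-1 *: g.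
have g1E : map_poly iE g1 = \prod_(z <- r) ('X - z%:P).
  apply/eqP; rewrite -eqp_monic ?monic_prod_XsubC //.
    apply: eqp_trans gr; rewrite map_polyZ eqp_scale // fmorph_eq0.
    by rewrite invr_eq0 lead_coef_eq0.
  by rewrite map_monic; apply/monicP; rewrite lead_coefZ mulVf ?lead_coef_eq0.
have unit_zy z : z \in r -> z / y != 0 /\ w (z / y) = 0.
  move=> /rP [z0 wz]; rewrite mulf_neq0 ?invr_eq0 //; split=> //.
  by rewrite (valM w_val) ?invr_eq0 // (valV w_val) // wz subrr.
have ge_zy z : z \in r -> val_ge w 0 (z / y).
  by move=> /unit_zy [_ wz]; rewrite /val_ge wz lexx orbT.
pose gh := \prod_(z <- r) ('X - (z / y)%:P).
pose h := \prod_(z <- r) ('X - (resE (z / y))%:P).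
have [gh_int hE] : integral_coefs w gh /\ map_poly resE gh = h.
  rewrite /gh /h big_seq [X in _ = X]big_seq.
  apply: (big_ind2 (fun A B => integral_coefs w A /\ map_poly resE A = B)).
  - split=> [k|]; first by rewrite coef1; exact: val_ge_nat.
    apply/polyP => k; rewrite (coef_resp resE_map) !coef1.
    exact: (res_nat w_val resE_map).
  - move=> A1 B1 A2 B2 [A1v <-] [A2v <-]; split; first exact: integral_coefsM.
    exact: (respM w_val resE_map).
  - move=> z zr; split; first by apply: (integral_coefsXsubC w_val); apply: ge_zy.
    by apply: (respXsubC w_val resE_map); apply: ge_zy.
(* A nonzero coefficient of h lifts to one of value 0, so the scaling formula gives size r / P =
   v(g1_k) + k / P, and v is integer-valued. *)
have h_coef k : h`_k != 0 -> (P %| `|(size r)%:Z - k%:Z|)%N.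
  rewrite -hE (coef_resp resE_map) => /(val_eq0_res resE_map (gh_int k)) [ghk0 wghk].
  have := coef_prod_XsubC_scale r k y0; rewrite -/gh -g1E coef_map => E1.
  have gk0 : g1`_k != 0.
    apply/eqP => gk; move/eqP: E1; rewrite gk raddf0 mul0r.
    by rewrite mulf_eq0 (negbTE ghk0) expf_eq0 (negbTE y0) andbF.
  move/(congr1 w): E1; rewrite !(valM w_val) ?expf_neq0 ?fmorph_eq0 //.
  rewrite !(valX w_val) // wghk add0r w_ext // => E2.
  have E3 : (size r)%:R = P%:R * (v g1`_k)%:~R + k%:R :> rat.
    move/(congr1 (fun t => P%:R * t)): E2; rewrite mulrDr.
    by rewrite -[w y *+ size r]mulr_natl -[w y *+ k]mulr_natl ![P%:R * (_%:R * w y)]mulrCA wy !mulr1.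
  have -> : (size r)%:Z - k%:Z = P%:Z * v g1`_k.
    apply/eqP; rewrite subr_eq -(inj_eq (@intr_inj rat)) rmorphD rmorphM /=.
    by rewrite -!pmulrn E3.
  by rewrite abszM dvdn_mulr.
(* The case k = 0 yields that P divides [size r], and hence every k with a nonzero coefficient. *)
have h0 : h`_0 != 0.
  rewrite -horner_coef0 /h horner_prod prodf_seq_neq0; apply/allP => z zr.
  rewrite !hornerE oppr_eq0; have [zy0 wzy] := unit_zy z zr.
  exact: (res_unit resE_map).
have Pr : (P %| size r)%N by have := h_coef 0%N h0; rewrite subr0.
have hP k : h`_k != 0 -> (P %| k)%N.
  move=> /h_coef; rewrite -[(P %| _)%N]/(P%:Z %| (size r)%:Z - k%:Z)%Z.
  by rewrite rpredBl.
have h1 : root h 1.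
  rewrite /h -(big_map (fun z => resE (z / y)) xpredT (fun t => 'X - t%:P)).
  rewrite root_prod_XsubC; apply/mapP; exists y => //.
  by rewrite mulfV // (res1 resE_map).
(* X^P - 1 divides the split polynomial h, so it splits over R; being separable, it has P distinct
   roots, among them a primitive one. *)
have := dvdp_Xn_sub_1 hP h1.
rewrite /h -(big_map (fun z => resE (z / y)) xpredT (fun t => 'X - t%:P)).
case/dvdp_prod_XsubC => msk; set rs := mask _ _ => Prs.
have P_R : P%:R != 0 :> R by rewrite /P natrX expf_neq0.
have rsu : uniq rs.
  by rewrite -separable_prod_XsubC -(eqp_separable Prs) separable_Xn_sub_1.
have rsP : all P.-unity_root rs.
  by apply/allP => z; rewrite -root_prod_XsubC -(eqp_root Prs).
have rss : (size rs >= P)%N.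
  by have := eqp_size Prs; rewrite size_Xn_sub_1 // size_prod_XsubC => -[->].
by have /hasP [z _ zP] := has_prim_root P_gt0 rsP rsu rss; exists z.
Qed.

End DivisibleValueGroup.

(** * Automorphisms of order p when the value group is p-indivisible *)

Lemma prime_order_fixed_point (T : choiceType) (s : T -> T) (rs : seq T) (p : nat) :
  prime p -> uniq rs -> (forall x, x \in rs -> s x \in rs) ->
  (forall x, iter p s x = x) -> ~~ (p %| size rs)%N ->
  exists2 x, x \in rs & s x = x.
Proof.
move=> p_pr urs srs sp np; pose f (x : seq_sub rs) := SeqSub (srs _ (valP x)).
have val_f n x : val (iter n f x) = iter n s (val x).
  by elim: n => //= n ->.
have f_inj : injective f.
  move=> x y fxy; apply: val_inj; rewrite -(sp (val x)) -(sp (val y)).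
  have /(congr1 val) /= sxy := fxy.
  by rewrite -(prednK (prime_gt0 p_pr)) !iterSr sxy.
pose a := perm f_inj.
have ap : (a ^+ p = 1)%g.
  apply/permP => x; rewrite perm1 permX; apply: val_inj.
  by rewrite (eq_iter (permE f_inj)) val_f sp.
(* For an action of a p-group, the number of fixed points is congruent to the size of the set modulo
   p. *)
have pG : (p.-group <[a]>)%g.
  rewrite /pgroup -orderE; apply: (@pnat_dvd _ p); last exact: pnat_id.
  by rewrite order_dvdn ap.
have acts : [acts <[a]>%g, on [set: seq_sub rs] | 'P].
  by apply/fintype.subsetP => x _; rewrite !inE; apply/fintype.subsetP => y _; rewrite !inE.
have := pgroup_fix_mod pG acts; rewrite cardsT card_seq_sub //.
have [->|/set0Pn [x]] := eqVneq ('Fix_([set: seq_sub rs] | 'P)(<[a]>))%g finset.set0.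
  by rewrite cards0 => /eqP; rewrite mod0n -/(dvdn _ _) (negbTE np).
rewrite inE => /andP [_ /afixP /(_ a (cycle_id a))] /= ax _.
exists (val x); first exact: valP.
by move/(congr1 val): ax; rewrite apermE permE.
Qed.

Section IndivisibleValueGroup.

Variables (K : fieldType) (v : K -> int) (E : fieldType) (iE : {rmorphism K -> E}).
Variables (w : E -> rat) (R : fieldType) (resE : E -> R) (p : nat).
Hypothesis v_disc : discrete_valuation v.
Hypothesis v_hens : henselian v.
Hypothesis iE_alg : algebraic_ext iE.
Hypothesis w_val : is_valuation w.
Hypothesis w_ext : extends_val iE v w.
Hypothesis E_dim1 : dim_le1 E.
Hypothesis resE_map : residue_map w resE.
Hypothesis p_pr : prime p.
Hypothesis w_indiv : val_indivisible w p.

Variables (L : fieldExtType R) (N : nat) (a : L).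
Hypothesis N_R : N%:R != 0 :> R.
Hypothesis a_prim : N.-primitive_root a.

Local Notation red g := (map_poly (in_alg L) (map_poly resE g)).

(** Starting from X^N - 1, a reducible g is replaced by one of two monic factors, integral by
    Gauss's lemma: the one whose reduction vanishes at [a]. *)
Lemma exists_irreducible_lift : exists g : {poly E},
  [/\ irreducible_poly g, g \is monic, integral_coefs w g, g %| 'X^N - 1 & root (red g) a].
Proof.
have N_gt0 := prim_order_gt0 a_prim.
suff main : forall n (g : {poly E}), (size g < n)%N -> g \is monic ->
    integral_coefs w g -> g %| 'X^N - 1 -> root (red g) a ->
    exists g : {poly E}, [/\ irreducible_poly g, g \is monic, integral_coefs w g,
      g %| 'X^N - 1 & root (red g) a].
  apply: (main _ ('X^N - 1) (leqnn _)).
  - exact: monic_Xn_sub_1.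
  - exact: integral_coefs_Xn_sub_1.
  - exact: dvdpp.
  - rewrite (resp_Xn_sub_1 w_val resE_map) rmorphB /= map_polyXn rmorph1.
    by rewrite /root !hornerE (prim_expr_order a_prim) subrr.
elim=> // n IH g; rewrite ltnS => gn gm gv gX ga.
have [irr|red_g] := pselect (irreducible_poly g); first by exists g.
have g1 : (1 < size g)%N.
  have [rm <-] := resp_monic resE_map gm.
  rewrite -(size_map_poly (in_alg L)); apply: root_size_gt1 ga.
  by rewrite map_poly_eq0 monic_neq0.
have [h [h1 hg nhg]] : exists h : {poly E}, [/\ size h != 1%N, h %| g & ~~ (h %= g)].
  apply: contrapT => noh; apply: red_g; split=> // h h1 hf; apply: contrapT => nhf.
  by apply: noh; exists h; split=> //; apply/negP.
have h0 : h != 0 by apply: contraTneq hg => ->; rewrite dvd0p monic_neq0.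
pose b := (lead_coef h)^-1 *: h.
have bh : b %= h by rewrite eqp_scale // invr_eq0 lead_coef_eq0.
have bm : b \is monic by apply/monicP; rewrite lead_coefZ mulVf ?lead_coef_eq0.
have bg : b %| g by rewrite (eqp_dvdl _ bh).
have [c [gE cm cv bv resg]] := monic_dvd_resp w_val resE_map bm gm gv bg.
have szg : size g = (size c + size b).-1 by rewrite gE size_Mmonic ?monic_neq0.
have b1 : (1 < size b)%N.
  by rewrite (eqp_size bh); move: h0 h1; rewrite -size_poly_gt0; case: (size h) => [|[]].
have bs : (size b < size g)%N.
  rewrite ltn_neqAle dvdp_leq ?monic_neq0 // andbT; apply: contra nhg => /eqP sz.
  by rewrite -(eqp_ltrans bh) -dvdp_size_eqp // sz.
have cs : (size c < size g)%N.
  by rewrite szg; case: (size b) b1 => // -[|m] // _; rewrite !addnS /= ltnS leq_addr.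
move: ga; rewrite resg rmorphM rootM => /orP [ca|ba].
  apply: (IH c) => //; first exact: leq_trans cs gn.
  by apply: dvdp_trans gX; rewrite gE dvdp_mulIl.
apply: (IH b) => //; first exact: leq_trans bs gn.
exact: dvdp_trans gX.
Qed.

Lemma val_nat_unit : N%:R != 0 :> E /\ w N%:R = 0.
Proof.
apply: (val_eq0_res resE_map); first exact: val_ge_nat.
by rewrite (res_nat w_val resE_map).
Qed.

Lemma prime_order_automorphism_prim_root (s : {rmorphism L -> L}) :
  (forall c : R, s c%:A = c%:A) -> (forall x, iter p s x = x) -> s a = a.
Proof.
move=> sR sp; have N_gt0 := prim_order_gt0 a_prim.
have [g [irr_g gm gv gX ga]] := exists_irreducible_lift.
have [N_E wN] := val_nat_unit.
have N_L : N%:R != 0 :> L by rewrite -(rmorph_nat (in_alg L)) fmorph_eq0.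
have red_Xn_sub_1 n : red ('X^n - 1) = 'X^n - 1.
  by rewrite (resp_Xn_sub_1 w_val resE_map) rmorphB /= map_polyXn rmorph1.
have root_Xn_sub_1 (F : fieldType) n (x : F) : root ('X^n - 1) x = (x ^+ n == 1).
  by rewrite /root !hornerE subr_eq0.
have g_dvd n : (0 < n)%N -> g %| 'X^n - 1 -> (N %| n)%N.
  move=> n0 gn; have := monic_dvd_resp w_val resE_map gm (monic_Xn_sub_1 E n0).
  case=> [||u [_ _ _ _]] //; first exact: integral_coefs_Xn_sub_1.
  move/(congr1 (map_poly (in_alg L))); rewrite rmorphM red_Xn_sub_1 => E1.
  rewrite (prim_order_dvd a_prim) -root_Xn_sub_1 E1 rootM ga.
  by rewrite orbT.
(* If a root z of g has order n, then g divides X^n - 1; reducing, a^n = 1, so N divides n. *)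
have prim_root (F : fieldType) (i : {rmorphism E -> F}) (z : F) :
    root (map_poly i g) z -> N.-primitive_root z.
  move=> gz; have zN : z ^+ N = 1.
    have := gX; rewrite -(dvdp_map i) rmorphB /= map_polyXn rmorph1.
    by move=> /root_dvdp /(_ gz); rewrite root_Xn_sub_1 => /eqP.
  have [n zn nN] := prim_order_exists N_gt0 zN.
  suff -> : N = n by [].
  apply/eqP; rewrite eqn_dvd nN andbT; apply: g_dvd; first exact: prim_order_gt0 zn.
  apply: irreducible_dvd_common_root irr_g gz _.
  by rewrite rmorphB /= map_polyXn rmorph1 root_Xn_sub_1 (prim_expr_order zn).
have split_dvd (F : fieldType) (h : {poly F}) (z : F) : N.-primitive_root z ->
    h %| 'X^N - 1 -> exists rs : seq F, uniq rs /\ h %= \prod_(r <- rs) ('X - r%:P).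
  move=> zN; rewrite -(factor_Xn_sub_1 zN).
  rewrite -(big_map (fun k => z ^+ k) xpredT (fun y => 'X - y%:P)).
  case/dvdp_prod_XsubC => msk hE; eexists; split; last exact: hE.
  apply: mask_uniq; rewrite map_inj_in_uniq ?iota_uniq // => k l.
  rewrite !mem_iota !add0n subn0 /= => kN lN /eqP.
  by rewrite (eq_prim_root_expr zN) !modn_small // => /eqP.
have [|||M [z [gz zM dimM galM]]] := @simple_galois_extension E g.
- exact: irr_g.
- exact: dvdp_separable gX (separable_Xn_sub_1 N_E).
- move=> F z gz; have [||rs [_ rsE]] := @split_dvd F (map_poly (in_alg F) g) z.
  + exact: prim_root gz.
  + by have := gX; rewrite -(dvdp_map (in_alg F)) rmorphB /= map_polyXn rmorph1.
  by exists rs.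
have zN : z ^+ N = 1 by apply: prim_expr_order; exact: prim_root gz.
have := prime_not_dvd_dim v_disc v_hens iE_alg w_val w_ext E_dim1 p_pr w_indiv
  N_E wN galM zM zN; rewrite dimM => np.
have gred : red g %| 'X^N - 1.
  have [u [_ _ _ _]] := monic_dvd_resp w_val resE_map gm (monic_Xn_sub_1 E N_gt0)
    (integral_coefs_Xn_sub_1 w_val N) gX.
  move/(congr1 (map_poly (in_alg L))); rewrite rmorphM red_Xn_sub_1 => ->.
  exact: dvdp_mulIr.
have [rs [urs rsE]] := split_dvd _ _ _ a_prim gred.
have [_ szg] := resp_monic resE_map gm.
have szrs : size rs = (size g).-1.
  by have := eqp_size rsE; rewrite size_map_poly szg size_prod_XsubC => ->.
have mem_rs x : (x \in rs) = root (red g) x by rewrite (eqp_root rsE) root_prod_XsubC.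
have s_rs x : x \in rs -> s x \in rs.
  rewrite !mem_rs => gx.
  have -> : red g = map_poly s (red g).
    by rewrite -[RHS]map_poly_comp; apply: eq_map_poly => c; rewrite /= sR.
  by rewrite fmorph_root.
rewrite -szrs in np.
have [b] := prime_order_fixed_point p_pr urs s_rs sp np.
rewrite mem_rs => gb sb.
have bN : b ^+ N = 1.
  by apply/eqP; rewrite -root_Xn_sub_1; exact: root_dvdp gred gb.
have [n bn nN] := prim_order_exists N_gt0 bN.
suff NE : N = n.
  have [j aj] := prim_rootP bn (etrans (congr1 (fun k => a ^+ k) (esym NE)) (prim_expr_order a_prim)).
  by rewrite aj rmorphXn sb.
have n_gt0 := prim_order_gt0 bn.
apply/eqP; rewrite eqn_dvd nN andbT; apply: g_dvd => //.
(* Let n be the order of b. If g does not divide X^n - 1, it divides the cofactor [Psi] of X^n - 1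
   in X^N - 1. Then b is a root of the reduction of [Psi], whose value at b is N/n, nonzero in L. *)
have [c Nc] := dvdnP nN.
pose Psi (F : fieldType) : {poly F} := \sum_(k < c) ('X^n) ^+ k.
have PsiE (F : fieldType) : 'X^N - 1 = ('X^n - 1) * Psi F.
  by rewrite Nc mulnC exprM subrX1.
apply: contraT => ngn.
have gPsi : g %| Psi E.
  have : g %| ('X^n - 1) * Psi E by rewrite -PsiE.
  rewrite Gauss_dvdpr // coprimep_def; apply: contraR ngn => sz.
  have /andP [_ gd] := irr_g.2 _ sz (dvdp_gcdl _ _).
  exact: dvdp_trans gd (dvdp_gcdr _ _).
have Xnm := monic_Xn_sub_1 E n_gt0.
have Psim : Psi E \is monic by rewrite -(monicMl _ Xnm) -PsiE monic_Xn_sub_1.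
have Psiv : integral_coefs w (Psi E).
  apply: (monic_factor_integral w_val resE_map Psim Xnm).
  by rewrite mulrC -PsiE; exact: integral_coefs_Xn_sub_1.
have redPsi : red (Psi E) = Psi L.
  apply: (mulfI (monic_neq0 (monic_Xn_sub_1 L n_gt0))).
  have Xnv := integral_coefs_Xn_sub_1 w_val n.
  have := congr1 (fun Q => red Q) (PsiE E).
  by rewrite /= (respM w_val resE_map) // rmorphM /= !red_Xn_sub_1 (PsiE L) => <-.
have [u [_ _ _ _ resPsi]] := monic_dvd_resp w_val resE_map gm Psim Psiv gPsi.
have : root (Psi L) b by rewrite -redPsi resPsi rmorphM rootM gb orbT.
rewrite /root horner_sum; under eq_bigr do rewrite !hornerE (prim_expr_order bn) expr1n.
rewrite sumr_const card_ord => c0.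
by move: N_L; rewrite Nc natrM mulf_eq0 negb_or c0.
Qed.

End IndivisibleValueGroup.

Theorem theorem2p1 (K : fieldType) (v : K -> int)
    (RK : finFieldType) (resK : K -> RK) (q : nat)
    (E : fieldType) (iE : {rmorphism K -> E}) (w : E -> rat)
    (RE : fieldType) (resE : E -> RE) :
  discrete_valuation v -> henselian v ->
  residue_map v resK -> q \in [pchar RK] ->
  galois_ext iE -> dim_le1 E ->
  is_valuation w -> extends_val iE v w -> residue_map w resE ->
  (forall p : nat, prime p -> p != q -> p_closed RE p) /\
  (val_indivisible w q -> p_closed RE q /\ alg_closed RE).
Proof.
move=> v_disc v_hens resK_map qRK E_gal E_dim1 w_val w_ext resE_map.
have v_val := proj1 v_disc; have q_pr := pcharf_prime qRK.
have iE_alg : algebraic_ext iE.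
  move=> y; have [g [irr_g [_ gy]]] := proj1 E_gal y; exists g; split=> //.
  by rewrite -size_poly_gt0 (ltn_trans _ irr_g.1).
have [i iP] := exists_residue_morphism v_val w_val w_ext resK_map resE_map.
have i_alg := residue_algebraic v_val w_val w_ext resK_map resE_map iP iE_alg.
have qRE : q \in [pchar RE] by rewrite -(fmorph_pchar i) in qRK.
have qL (L : fieldExtType RE) : q \in [pchar L] by rewrite pchar_lalg.
have frobL (L : fieldExtType RE) (a : L) : exists2 m, (0 < m)%N & a ^+ (q ^ m) = a.
  apply: (algebraic_finite_frobenius (qL L) (i := in_alg L \o i)).
  apply/integral_algebraic.
  have [P [P0 Pa]] := algebraic_ext_comp i_alg (@fieldExt_algebraic _ L) a.
  by exists P.
(* This serves both conclusions: p = q is covered exactly when w(E) is q-indivisible, and then every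
   prime is. *)
have auts p : prime p -> p != q \/ val_indivisible w p ->
    forall (L : fieldExtType RE) (s : {rmorphism L -> L}),
    (forall c : RE, s c%:A = c%:A) -> (forall x, iter p s x = x) ->
    forall x, s x = x.
  move=> p_pr pq L s sR sp a; have [m m0 am] := frobL L a.
  have [w_indiv|w_div] := pselect (val_indivisible w p).
    have [->|a0] := eqVneq a 0; first exact: rmorph0.
    (* The order N of a nonzero [a] divides q^m - 1, so it is prime to q and nonzero in the residue
       field. *)
    have q1 := prime_gt1 q_pr.
    have qm1 : (0 < q ^ m - 1)%N by rewrite subn_gt0 -(exp1n m) ltn_exp2r.
    have aN : a ^+ (q ^ m - 1) = 1.
      apply: (mulfI a0); rewrite mulr1 -exprS subn1 prednK ?am //.
      by rewrite expn_gt0 prime_gt0.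
    have [N a_prim Nqm] := prim_order_exists qm1 aN.
    have N_R : N%:R != 0 :> RE.
      rewrite -(dvdn_pcharf qRE); apply/negP => qN; have := dvdn_trans qN Nqm.
      rewrite dvdn_subr ?expn_gt0 ?prime_gt0 ?dvdn_exp // dvdn1 => /eqP q_eq1.
      by rewrite q_eq1 in q1.
    exact: (prime_order_automorphism_prim_root v_disc v_hens iE_alg w_val w_ext
      E_dim1 resE_map p_pr w_indiv N_R a_prim).
  have pq' : p != q by case: pq.
  apply: (automorphism_fixes_unity (qL L) p_pr pq' sp m0 am) => n.
  have p_R : p%:R != 0 :> RE by rewrite -(dvdn_pcharf qRE) dvdn_prime2 // eq_sym.
  have [z z_prim] := residue_pfactor_unity v_disc v_hens E_gal w_val w_ext resE_map
    p_pr w_div p_R n.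
  by exists z%:A; rewrite sR -[z%:A]/(in_alg L z) fmorph_primitive_root.
split=> [p p_pr pq|q_indiv].
  by apply: p_closed_of_automorphisms => //; apply: auts => //; left.
split; first by apply: p_closed_of_automorphisms => //; apply: auts => //; right.
apply: (alg_closed_of_automorphisms qRE frobL) => p p_pr; apply: auts => //.
by have [->|] := eqVneq p q; [right|left].
Qed.
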